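(* Let $f(z)=z+\sum_{n\ge2}a_nz^n$ belong to the class $C$ of normalized convex univalent functions and let $\beta$ be its lower order. Then $\beta=|a_2|$ if and only if either $a_2=0$ or $f$ is a rotation of $s_\alpha$ for some $\alpha\in[0,1]$.
   Context: $\mathbb{D}$ is the open unit disk. $S$ is the class of univalent (injective holomorphic) functions $f(z)=z+\sum_{n=2}^\infty a_nz^n$ in $\mathbb{D}$. $C\subset S$ consists of those $f\in S$ whose range $f(\mathbb{D})$ is a convex set. The lower order of $f$ is $$\beta=\inf_{\zeta\in\mathbb{D}}|A_f(\zeta)|,\qquad A_f(\zeta)=\frac12(1-|\zeta|^2)\frac{f''(\zeta)}{f'(\zeta)}-\overline{\zeta}.$$ For $\alpha\in[0,1]$ the sector function is $s_\alpha(z)=\frac1{2\alpha}\left[\left(\frac{1+z}{1-z}\right)^\alpha-1\right]$, understood as $s_0(z)=\frac12\log\frac{1+z}{1-z}$ when $\alpha=0$. A rotation of a function $g$ is a function $z\mapsto\overline{\lambda}g(\lambda z)$ with $|\lambda|=1$. *)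

(* Defs.v *)
From Stdlib Require Import Reals.
From Coquelicot Require Import Coquelicot.

Open Scope R_scope.

Definition in_disk (z : C) : Prop := Cmod z < 1.

(* Functions on the disk are represented by total functions [C -> C] whose
   values outside the disk are irrelevant. *)
Definition holomorphic_on_disk (f : C -> C) : Prop :=
  forall z : C, in_disk z -> ex_derive (K := C_AbsRing) (V := C_NormedModule) f z.

Definition univalent_on_disk (f : C -> C) : Prop :=
  holomorphic_on_disk f /\
  forall z w : C, in_disk z -> in_disk w -> f z = f w -> z = w.

(* f(z) = z + a_2 z^2 + a_3 z^3 + ... in the disk; by uniqueness of power
   series coefficients, [f] determines [a]. *)
Definition normalized_expansion (f : C -> C) (a : nat -> C) : Prop :=
  a 0%nat = RtoC 0 /\ a 1%nat = RtoC 1 /\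
  forall z : C, in_disk z ->
    is_pseries (K := C_AbsRing) (V := C_NormedModule) a z (f z).

Definition class_S (f : C -> C) : Prop :=
  univalent_on_disk f /\ exists a : nat -> C, normalized_expansion f a.

Definition image_of_disk (f : C -> C) (w : C) : Prop :=
  exists z : C, in_disk z /\ f z = w.

Definition convex_set (E : C -> Prop) : Prop :=
  forall (u v : C) (t : R), E u -> E v -> 0 <= t <= 1 ->
    E (RtoC (1 - t) * u + RtoC t * v)%C.

Definition class_C (f : C -> C) : Prop :=
  class_S f /\ convex_set (image_of_disk f).

(* [C_derive] is a total operator; it agrees with the complex derivative at
   every point of complex differentiability ([is_C_derive_unique]), hence at
   all points of the disk when [f] is in the class S. *)
Definition A_op (f : C -> C) (zeta : C) : C :=
  (RtoC (/ 2 * (1 - Cmod zeta ^ 2))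
     * (C_derive (C_derive f) zeta / C_derive f zeta)
   - Cconj zeta)%C.

(* The set is nonempty and bounded below by 0, so [Glb_Rbar] is finite here. *)
Definition lower_order (f : C -> C) : R :=
  real (Glb_Rbar (fun r : R => exists zeta : C,
    in_disk zeta /\ r = Cmod (A_op f zeta))).

Definition Cexp (z : C) : C :=
  (exp (Re z) * cos (Im z), exp (Re z) * sin (Im z)).

(* Principal argument, in (-PI, PI], of a nonzero [w]. *)
Definition Carg (w : C) : R :=
  if Rle_dec 0 (Im w) then acos (Re w / Cmod w) else - acos (Re w / Cmod w).

Definition Clog (w : C) : C := (ln (Cmod w), Carg w).

Definition Crpow (w : C) (alpha : R) : C := Cexp (RtoC alpha * Clog w)%C.

(* For [z] in the disk, (1 + z) / (1 - z) lies in the right half-plane, where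
   the principal branches are holomorphic. *)
Definition sector (alpha : R) (z : C) : C :=
  let w := ((RtoC 1 + z) / (RtoC 1 - z))%C in
  if Req_dec_T alpha 0
  then (RtoC (/ 2) * Clog w)%C
  else (RtoC (/ (2 * alpha)) * (Crpow w alpha - RtoC 1))%C.

Definition is_rotation_of (f g : C -> C) : Prop :=
  exists lambda : C, Cmod lambda = 1 /\
    forall z : C, in_disk z -> f z = (Cconj lambda * g (lambda * z))%C.

(* Main.v *)
Require Import Defs.
From Stdlib Require Import Reals Lra Psatz ClassicalEpsilon.
From Coquelicot Require Import Coquelicot.
Open Scope R_scope.

(** Put X = f''/f', so that A_f(z) = (1 - |z|^2) X(z) / 2 - conj z and
    A_f(0) = a_2. Hence the lower order is at most |a_2|, and it equals |a_2|
    exactly when |A_f| attains its minimum over the disk at 0.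

    If f is a rotation of s_alpha by lambda, then with w = lambda z,
    P = 1 - |w|^2 and y = Im w one finds
    |A_f(z)|^2 = (alpha^2 P^2 + 4 y^2) / (P^2 + 4 y^2), which is at least
    alpha^2 = |a_2|^2 because alpha <= 1 [rotation_A_value_ge].

    Conversely let a_2 <> 0 and let |A_f| be minimal at 0. With X'(0) = 2c, the
    vanishing of the first variation of |A_f|^2 at 0 says conj(a_2) c = a_2
    [critical_coefficient]. Convexity gives |A_f| <= 1 on the disk
    [convex_A_value_le_1], and this is the same as |phi| <= 1 for
    phi = X / (2 + z X). Since phi(0) = a_2 and phi'(0) = c - a_2^2 has modulus
    1 - |a_2|^2, phi attains equality in the Schwarz-Pick inequality at 0 and is
    therefore a Moebius map [schwarz_pick_equality]. Solving for X shows that f'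
    has the logarithmic derivative of a rotated sector function with
    alpha = |a_2| [rotation_of_log_derivative].

    The bound |A_f| <= 1 is the estimate |F''(0)| <= 2 |F'(0)| for convex
    univalent F [convex_second_coefficient], applied to f composed with the disk
    automorphisms. By convexity (F(z) + F(-z)) / 2 = F(omega(z)) with omega a
    self-map of the disk, and omega(z) = F''(0) / (2 F'(0)) z^2 + ..., so that
    Cauchy's estimate for the second coefficient of omega gives the claim.

    The function theory rests on one integral identity. All functions involved
    have a continuous complex derivative, because f is the sum of a power series
    [zderiv_power_sum]; Cauchy's formula for circles therefore follows by
    contracting the circle to a point and differentiating under the integral
    sign [deformation]. Mean values, a maximum principle [sup_bound] and the
    equality case of the Schwarz lemma [schwarz_equality] come from it. The
    maximum principle applied to suitable reciprocals shows that an injective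
    holomorphic function is open [open_mapping] and has a derivative without
    zeros [injective_derivative_neq_0], which makes omega holomorphic. *)

(** * Continuity of complex-valued functions *)

Notation ccont g t := (continuous (U := C_UniformSpace) g t).

Lemma ccont_iff {T : UniformSpace} (g : T -> C) (t : T) :
  ccont g t <->
  continuous (fun s => Re (g s)) t /\ continuous (fun s => Im (g s)) t.
Proof.
  split.
  - intros H; split.
    + apply (continuous_comp (V := C_UniformSpace) g fst); [exact H|].
      destruct (g t); apply continuous_fst.
    + apply (continuous_comp (V := C_UniformSpace) g snd); [exact H|].
      destruct (g t); apply continuous_snd.
  - intros [H1 H2].
    apply (continuous_ext (fun s => (Re (g s), Im (g s)) : C_UniformSpace)).
    { intros s; now destruct (g s). }
    apply (continuous_comp_2 (fun s => Re (g s)) (fun s => Im (g s))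
             (fun x y => (x, y) : C_UniformSpace)); auto.
    apply (continuous_ext (fun z : R * R => z)).
    { now intros []. }
    apply continuous_id.
Qed.

Section Continuity.
Context {T : UniformSpace}.
Implicit Types (g h : T -> C) (t : T).

Lemma continuous_Rplus (u v : T -> R) t :
  continuous u t -> continuous v t -> continuous (fun s => u s + v s) t.
Proof. exact (continuous_plus (V := R_NormedModule) u v t). Qed.

Lemma continuous_Rmult (u v : T -> R) t :
  continuous u t -> continuous v t -> continuous (fun s => u s * v s) t.
Proof. exact (continuous_mult (K := R_AbsRing) u v t). Qed.

Lemma continuous_Ropp (u : T -> R) t :
  continuous u t -> continuous (fun s => - u s) t.
Proof. exact (continuous_opp (V := R_NormedModule) u t). Qed.

Lemma ccont_const (c : C) t : ccont (fun _ => c) t.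
Proof. apply continuous_const. Qed.

Lemma ccont_plus g h t :
  ccont g t -> ccont h t -> ccont (fun s => g s + h s)%C t.
Proof.
  rewrite !ccont_iff; intros [] []; split; simpl; now apply continuous_Rplus.
Qed.

Lemma ccont_opp g t : ccont g t -> ccont (fun s => - g s)%C t.
Proof.
  rewrite !ccont_iff; intros []; split; simpl; now apply continuous_Ropp.
Qed.

Lemma ccont_minus g h t :
  ccont g t -> ccont h t -> ccont (fun s => g s - h s)%C t.
Proof. intros; apply ccont_plus, ccont_opp; auto. Qed.

Lemma ccont_mult g h t :
  ccont g t -> ccont h t -> ccont (fun s => g s * h s)%C t.
Proof.
  rewrite !ccont_iff; intros [] []; split; simpl.
  - apply continuous_Rplus; [|apply continuous_Ropp]; now apply continuous_Rmult.
  - apply continuous_Rplus; now apply continuous_Rmult.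
Qed.

Lemma continuous_Rinv_gen (u : T -> R) t :
  continuous u t -> u t <> 0 -> continuous (fun s => / u s) t.
Proof.
  intros H1 H2; apply (continuous_comp u Rinv); auto.
  now apply continuous_Rinv.
Qed.

Lemma ccont_RtoC (u : T -> R) t : continuous u t -> ccont (fun s => RtoC (u s)) t.
Proof.
  rewrite !ccont_iff; intros; split; simpl; auto; apply continuous_const.
Qed.

Lemma ccont_inv g t : ccont g t -> g t <> RtoC 0 -> ccont (fun s => / g s)%C t.
Proof.
  rewrite !ccont_iff; intros [H1 H2] H0.
  assert (Hn : fst (g t) ^ 2 + snd (g t) ^ 2 <> 0).
  { intros E; apply H0; destruct (g t) as [x y]; simpl in E.
    assert (x = 0) by nra; assert (y = 0) by nra; now subst. }
  assert (Hc : continuous (fun s => / (fst (g s) ^ 2 + snd (g s) ^ 2)) t).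
  { apply continuous_Rinv_gen; auto; simpl.
    apply continuous_Rplus; apply continuous_Rmult; auto;
      apply continuous_Rmult; auto; apply continuous_const. }
  split; simpl; unfold Rdiv; apply continuous_Rmult; auto.
  now apply continuous_Ropp.
Qed.

Lemma ccont_div g h t :
  ccont g t -> ccont h t -> h t <> RtoC 0 -> ccont (fun s => g s / h s)%C t.
Proof. intros; apply ccont_mult, ccont_inv; auto. Qed.

Lemma continuous_Cmod g t : ccont g t -> continuous (fun s => Cmod (g s)) t.
Proof.
  rewrite ccont_iff; intros [H1 H2]; unfold Cmod; simpl.
  apply (continuous_comp _ sqrt); [|apply continuous_sqrt].
  apply continuous_Rplus; apply continuous_Rmult; auto;
    apply continuous_Rmult; auto; apply continuous_const.
Qed.

Lemma continuous_pos_locally (u : T -> R) t :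
  continuous u t -> 0 < u t -> locally t (fun s => 0 < u s).
Proof. intros H1 H2; apply H1. now apply (open_gt 0). Qed.

Lemma ccont_neq_locally g (c : C) t :
  ccont g t -> g t <> c -> locally t (fun s => g s <> c).
Proof.
  intros H1 H2.
  assert (H3 : locally t (fun s => 0 < Cmod (g s - c))).
  { apply continuous_pos_locally.
    - apply continuous_Cmod, ccont_minus; auto using ccont_const.
    - apply Cmod_gt_0; intros E; apply H2.
      replace (g t) with (g t - c + c)%C by ring. rewrite E; ring. }
  apply filter_imp with (2 := H3); intros s Hs E.
  rewrite E in Hs; replace (c - c)%C with (RtoC 0) in Hs by ring.
  rewrite Cmod_0 in Hs; lra.
Qed.
End Continuity.

Lemma locally_Cmod (z : C) (P : C -> Prop) :
  locally (T := C_UniformSpace) z P <->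
  exists d : R, 0 < d /\ forall w, Cmod (w - z) < d -> P w.
Proof.
  split.
  - intros [d Hd]; exists d; split; [apply cond_pos|].
    intros w Hw; apply Hd. now apply C_NormedModule_mixin_compat1.
  - intros [d [Hd H]].
    assert (Hs : 0 < d / sqrt 2) by (apply Rdiv_lt_0_compat; auto; apply Rlt_sqrt2_0).
    exists (mkposreal _ Hs); intros w Hw; apply H.
    generalize (C_NormedModule_mixin_compat2 z w (mkposreal _ Hs) Hw); simpl.
    replace (sqrt 2 * (d / sqrt 2)) with d; auto.
    field. generalize Rlt_sqrt2_0; lra.
Qed.

Lemma ccont_eps {T : UniformSpace} (g : T -> C) (t : T) :
  ccont g t <-> forall e : R, 0 < e -> locally t (fun s => Cmod (g s - g t) < e).
Proof.
  split.
  - intros H e He; apply (H (fun w => Cmod (w - g t) < e)), locally_Cmod.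
    exists e; auto.
  - intros H P HP; apply locally_Cmod in HP; destruct HP as [d [Hd HP]].
    unfold filtermap; apply filter_imp with (2 := H d Hd); auto.
Qed.

(** * Derivatives along the line and in the plane *)

(** Caratheodory's form of the derivative, with respect to a coordinate [iota]
    that is either the inclusion of the real line in the plane or the identity
    of the plane. One set of rules then serves both kinds of derivative, and the
    chain rule mixing them needs no case distinction. *)
Definition cderiv {T : UniformSpace} (iota : T -> C) (g : T -> C) (t : T) (d : C) :=
  exists q : T -> C, ccont q t /\ q t = d /\
    locally t (fun s => g s = g t + q s * (iota s - iota t))%C.

Notation zderiv := (cderiv (T := C_UniformSpace) (fun w => w)).
Notation rderiv := (cderiv (T := R_UniformSpace) RtoC).

Section Derivation.
Context {T : UniformSpace} (iota : T -> C).
Implicit Types (g h : T -> C) (t : T).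

Lemma cderiv_ext_loc g h t d :
  locally t (fun s => g s = h s) -> cderiv iota g t d -> cderiv iota h t d.
Proof.
  intros E [q [Hq [Hd Hl]]]; exists q; split; [|split]; auto.
  assert (E0 := locally_singleton _ _ E); simpl in E0.
  apply filter_imp with (2 := filter_and _ _ E Hl); intros s [E1 E2].
  now rewrite <- E1, E2, E0.
Qed.

Lemma cderiv_ext g h t d :
  (forall s, g s = h s) -> cderiv iota g t d -> cderiv iota h t d.
Proof. intros E; apply cderiv_ext_loc, filter_forall; auto. Qed.

Lemma cderiv_eq g t d e : cderiv iota g t d -> d = e -> cderiv iota g t e.
Proof. now intros H <-. Qed.

Lemma cderiv_const (c : C) t : cderiv iota (fun _ => c) t 0.
Proof.
  exists (fun _ => RtoC 0); split; [apply ccont_const|split; auto].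
  apply filter_forall; intros; ring.
Qed.

Lemma cderiv_iota t : cderiv iota iota t 1.
Proof.
  exists (fun _ => RtoC 1); split; [apply ccont_const|split; auto].
  apply filter_forall; intros; ring.
Qed.

Lemma cderiv_plus g h t d e :
  cderiv iota g t d -> cderiv iota h t e -> cderiv iota (fun s => g s + h s)%C t (d + e)%C.
Proof.
  intros [q [Hq [Hd Hl]]] [r [Hr [He Hm]]].
  exists (fun s => q s + r s)%C; split; [now apply ccont_plus|split].
  - now rewrite Hd, He.
  - apply filter_imp with (2 := filter_and _ _ Hl Hm); intros s [-> ->]; ring.
Qed.

Lemma cderiv_mult g h t d e :
  ccont iota t ->
  cderiv iota g t d -> cderiv iota h t e ->
  cderiv iota (fun s => g s * h s)%C t (d * h t + g t * e)%C.
Proof.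
  intros Hi [q [Hq [Hd Hl]]] [r [Hr [He Hm]]].
  exists (fun s => q s * h t + (g t + q s * (iota s - iota t)) * r s)%C.
  split; [|split].
  - apply ccont_plus; [|apply ccont_mult; auto; apply ccont_plus];
    try apply ccont_mult; try apply ccont_minus; auto using ccont_const.
  - rewrite Hd, He; ring.
  - apply filter_imp with (2 := filter_and _ _ Hl Hm); intros s [-> ->]; ring.
Qed.

Lemma cderiv_scal (c : C) g t d :
  cderiv iota g t d -> cderiv iota (fun s => c * g s)%C t (c * d)%C.
Proof.
  intros [q [Hq [Hd Hl]]]; exists (fun s => c * q s)%C; split; [|split].
  - apply ccont_mult; auto using ccont_const.
  - now rewrite Hd.
  - apply filter_imp with (2 := Hl); intros s ->; ring.
Qed.

Lemma cderiv_opp g t d :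
  cderiv iota g t d -> cderiv iota (fun s => - g s)%C t (- d)%C.
Proof.
  intros H; apply (cderiv_scal (- (1))%C) in H.
  replace (- d)%C with (- (1) * d)%C by ring.
  apply cderiv_ext with (2 := H); intros; ring.
Qed.

Lemma cderiv_minus g h t d e :
  cderiv iota g t d -> cderiv iota h t e -> cderiv iota (fun s => g s - h s)%C t (d - e)%C.
Proof. intros; apply cderiv_plus, cderiv_opp; auto. Qed.

Lemma cderiv_ccont g t d : ccont iota t -> cderiv iota g t d -> ccont g t.
Proof.
  intros Hi [q [Hq [Hd Hl]]].
  apply (continuous_ext_loc _ (fun s => g t + q s * (iota s - iota t))%C).
  { apply filter_imp with (2 := Hl); auto. }
  apply ccont_plus, ccont_mult, ccont_minus; auto using ccont_const.
Qed.

Lemma cderiv_comp (g : C -> C) h t d e :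
  ccont iota t ->
  zderiv g (h t) d -> cderiv iota h t e -> cderiv iota (fun s => g (h s)) t (d * e)%C.
Proof.
  intros Hi [q [Hq [Hd Hl]]] Hh.
  assert (Hc := cderiv_ccont _ _ _ Hi Hh).
  destruct Hh as [r [Hr [He Hm]]].
  exists (fun s => q (h s) * r s)%C; split; [|split].
  - apply ccont_mult; auto. now apply (continuous_comp h q).
  - now rewrite Hd, He.
  - assert (Hl' := Hc _ Hl); unfold filtermap in Hl'.
    apply filter_imp with (2 := filter_and _ _ Hl' Hm); intros s [-> E].
    replace (h s - h t)%C with (r s * (iota s - iota t))%C by (rewrite E; ring).
    ring.
Qed.

Lemma cderiv_inv g t d :
  ccont iota t -> g t <> RtoC 0 ->
  cderiv iota g t d -> cderiv iota (fun s => / g s)%C t (- d / (g t * g t))%C.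
Proof.
  intros Hi H0 Hg.
  assert (Hc := cderiv_ccont _ _ _ Hi Hg).
  destruct Hg as [q [Hq [Hd Hl]]].
  exists (fun s => - q s / (g s * g t))%C; split; [|split].
  - apply ccont_div; [now apply ccont_opp| |now apply Cmult_neq_0].
    apply ccont_mult; auto using ccont_const.
  - now rewrite Hd.
  - apply filter_imp with (2 := filter_and _ _ Hl (ccont_neq_locally _ _ _ Hc H0)).
    intros s [E Hs].
    replace (/ g s)%C with (/ g t - (g s - g t) / (g s * g t))%C by now field.
    replace (g s - g t)%C with (q s * (iota s - iota t))%C by (rewrite E; ring).
    now field.
Qed.

Lemma cderiv_div g h t d e :
  ccont iota t -> h t <> RtoC 0 ->
  cderiv iota g t d -> cderiv iota h t e ->
  cderiv iota (fun s => g s / h s)%C t ((d * h t - g t * e) / (h t * h t))%C.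
Proof.
  intros Hi H0 Hg Hh.
  replace ((d * h t - g t * e) / (h t * h t))%C
    with (d * / h t + g t * (- e / (h t * h t)))%C by now field.
  now apply cderiv_mult, cderiv_inv.
Qed.

(** The derivative of a continuous lift of a differentiable function through
    [F]: division by the slope of [F] is legitimate near [t] because that slope
    is continuous and nonzero. Inverse functions are the special case where the
    composite is the identity. *)
Lemma cderiv_lift (F : C -> C) h t d e :
  ccont h t -> zderiv F (h t) d -> d <> RtoC 0 ->
  cderiv iota (fun s => F (h s)) t e -> cderiv iota h t (e / d)%C.
Proof.
  intros Hh [Q [HQ [Hd Hl]]] H0 [q [Hq [He Hm]]].
  assert (HQh : ccont (fun s => Q (h s)) t) by now apply (continuous_comp h Q).
  assert (Hl' := Hh _ Hl); unfold filtermap in Hl'.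
  assert (N : locally t (fun s => Q (h s) <> RtoC 0)).
  { apply ccont_neq_locally; auto; now rewrite Hd. }
  exists (fun s => q s / Q (h s))%C; split; [|split].
  - apply ccont_div; auto. cbv beta; now rewrite Hd.
  - now rewrite Hd, He.
  - apply filter_imp with (2 := filter_and _ _ (filter_and _ _ Hl' N) Hm).
    intros s [[E1 E2] E3]; rewrite E3 in E1.
    assert (E : (q s * (iota s - iota t) = Q (h s) * (h s - h t))%C).
    { replace (q s * (iota s - iota t))%C
        with (F (h t) + q s * (iota s - iota t) - F (h t))%C by ring.
      rewrite E1; ring. }
    replace (q s / Q (h s) * (iota s - iota t))%C
      with (q s * (iota s - iota t) / Q (h s))%C by (field; auto).
    rewrite E; field; auto.
Qed.
End Derivation.

Lemma ccont_id (z : C) : ccont (fun w : C => w) z.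
Proof. apply continuous_id. Qed.

Lemma ccont_of_R (t : R) : ccont (RtoC : R_UniformSpace -> C) t.
Proof. apply ccont_RtoC, continuous_id. Qed.

Lemma zderiv_is_derive (g : C -> C) (z d : C) :
  zderiv g z d <-> is_derive (K := C_AbsRing) (V := C_NormedModule) g z d.
Proof.
  split.
  - intros [q [Hq [Hd Hl]]]; split; [apply is_linear_scal_l|].
    intros x Hx.
    assert (Ex : z = x)
      by exact (is_filter_lim_locally_unique (V := AbsRing_NormedModule C_AbsRing) z x Hx).
    subst x. intros e.
    apply ccont_eps with (e := e) in Hq; [|apply cond_pos].
    apply (proj1 (locally_C z _)).
    apply filter_imp with (2 := filter_and _ _ Hl Hq); intros w [E Hw].
    change (Cmod (g w - g z - (w - z) * d) <= e * Cmod (w - z)).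
    rewrite E, <- Hd.
    replace (g z + q w * (w - z) - g z - (w - z) * q z)%C
      with ((q w - q z) * (w - z))%C by ring.
    rewrite Cmod_mult; apply Rmult_le_compat_r; [apply Cmod_ge_0|lra].
  - intros [_ H].
    exists (fun w => if excluded_middle_informative (w = z) then d
                     else ((g w - g z) / (w - z))%C).
    assert (E0 : forall w : C, w <> z -> (w - z)%C <> RtoC 0).
    { intros w Hw E; apply Hw; replace w with (w - z + z)%C by ring; rewrite E; ring. }
    split; [|split].
    + apply ccont_eps; intros e He.
      assert (He' : 0 < e / 2) by lra.
      assert (H1 := H z (fun P HP => HP) (mkposreal _ He')).
      assert (H2 : locally (T := C_UniformSpace) z (fun w : C =>
        Cmod (g w - g z - (w - z) * d) <= e / 2 * Cmod (w - z)))
        by exact (proj2 (locally_C z _) H1).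
      apply filter_imp with (2 := H2); intros w Hw.
      destruct (excluded_middle_informative (z = z)) as [_|]; [|tauto].
      destruct (excluded_middle_informative (w = z)) as [_|n].
      * replace (d - d)%C with (RtoC 0) by ring; rewrite Cmod_0; lra.
      * apply E0 in n.
        replace ((g w - g z) / (w - z) - d)%C
          with ((g w - g z - (w - z) * d) / (w - z))%C by now field.
        rewrite Cmod_div; auto.
        apply Rle_lt_trans with (e / 2); [|lra].
        apply Cmod_gt_0 in n. apply Rle_div_l; auto.
    + destruct (excluded_middle_informative (z = z)); tauto.
    + apply filter_forall; intros w.
      match goal with |- context [excluded_middle_informative ?A] =>
        destruct (excluded_middle_informative A) as [E|n] end.
      * change (w = z) in E; subst w; ring.
      * apply E0 in n; now field.
Qed.

Lemma rderiv_Re (g : R -> C) (t : R) (d : C) :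
  rderiv g t d -> is_derive (fun s => Re (g s)) t (Re d).
Proof.
  intros [q [Hq [Hd Hl]]]; split; [apply is_linear_scal_l|].
  intros x Hx.
  assert (Ex : t = x)
    by exact (is_filter_lim_locally_unique (V := AbsRing_NormedModule R_AbsRing) t x Hx).
  subst x.
  intros e.
  apply ccont_eps with (e := e) in Hq; [|apply cond_pos].
  apply filter_imp with (2 := filter_and _ _ Hl Hq); intros s [E Hs].
  change (Rabs (Re (g s) - Re (g t) - (s - t) * Re d) <= e * Rabs (s - t)).
  rewrite E, <- Hd.
  replace (Re (g t + q s * (RtoC s - RtoC t))%C - Re (g t) - (s - t) * Re (q t))
    with (Re (q s - q t)%C * (s - t)).
  2: { unfold Re; simpl; ring. }
  rewrite Rabs_mult; apply Rmult_le_compat_r; [apply Rabs_pos|].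
  apply Rle_trans with (2 := Rlt_le _ _ Hs), re_le_Cmod.
Qed.

Lemma rderiv_Im (g : R -> C) (t : R) (d : C) :
  rderiv g t d -> is_derive (fun s => Im (g s)) t (Im d).
Proof.
  intros H; apply (cderiv_scal _ (- Ci)%C), rderiv_Re in H.
  replace (Im d) with (Re (- Ci * d)%C) by (unfold Re, Im; simpl; ring).
  apply is_derive_ext with (2 := H); intros; unfold Re, Im; simpl; ring.
Qed.

Lemma is_derive_rderiv (u v : R -> R) (t du dv : R) :
  is_derive u t du -> is_derive v t dv ->
  rderiv (fun s => (u s, v s)) t (du, dv).
Proof.
  assert (W : forall (w : R -> R) dw, is_derive w t dw ->
    rderiv (fun s => RtoC (w s)) t (RtoC dw)).
  { intros w dw [_ H].
    exists (fun s => RtoC (if Req_dec_T s t then dw else (w s - w t) / (s - t))).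
    split; [|split].
    - apply ccont_RtoC. intros P [d HP].
      assert (Hd : 0 < d / 2) by (generalize (cond_pos d); lra).
      assert (H1 := H t (fun P HP => HP) (mkposreal _ Hd)).
      unfold filtermap; apply filter_imp with (2 := H1); intros s Hs; apply HP.
      change (Rabs (w s - w t - (s - t) * dw) <= d / 2 * Rabs (s - t)) in Hs.
      destruct (Req_dec_T t t) as [_|]; [|lra].
      destruct (Req_dec_T s t) as [_|n]; [apply ball_center|].
      change (Rabs ((w s - w t) / (s - t) - dw) < d).
      replace ((w s - w t) / (s - t) - dw)
        with ((w s - w t - (s - t) * dw) / (s - t)) by (field; lra).
      rewrite Rabs_div; [|lra].
      apply Rle_lt_trans with (d / 2); [|generalize (cond_pos d); lra].
      apply Rle_div_l; auto. apply Rabs_pos_lt; lra.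
    - destruct (Req_dec_T t t); [auto|lra].
    - apply filter_forall; intros s.
      destruct (Req_dec_T s t) as [->|n]; [ring|].
      rewrite <- RtoC_minus, <- RtoC_mult, <- RtoC_plus; f_equal; field; lra. }
  intros Hu Hv; apply W in Hu; apply W in Hv.
  apply (cderiv_scal _ Ci) in Hv.
  assert (H := cderiv_plus _ _ _ _ _ _ Hu Hv).
  replace (du, dv) with (du + Ci * dv)%C
    by (unfold Cplus, Cmult; simpl; f_equal; ring).
  apply cderiv_ext with (2 := H); intros s.
  unfold Cplus, Cmult; simpl; f_equal; ring.
Qed.

(** * Deforming a circle to a point *)

(** Continuity of the derivative is part of the notion: it is what allows
    differentiation under the integral sign without Goursat's theorem. *)
Definition C1hol (U : C -> Prop) (g : C -> C) :=
  exists g' : C -> C, forall z, U z -> zderiv g z (g' z) /\ ccont g' z.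

Lemma C1hol_ccont U g z : C1hol U g -> U z -> ccont g z.
Proof.
  intros [g' H] Hz; apply H in Hz; destruct Hz as [Hz _].
  apply cderiv_ccont with (2 := Hz), ccont_id.
Qed.

Lemma C1hol_sub (U V : C -> Prop) g :
  C1hol V g -> (forall z, U z -> V z) -> C1hol U g.
Proof. intros [g' H] HU; exists g'; auto. Qed.

Lemma C1hol_const U c : C1hol U (fun _ => c).
Proof. exists (fun _ => RtoC 0); split; [apply cderiv_const|apply ccont_const]. Qed.

Lemma C1hol_id U : C1hol U (fun z => z).
Proof. exists (fun _ => RtoC 1); split; [apply cderiv_iota|apply ccont_const]. Qed.

Lemma C1hol_plus U g h : C1hol U g -> C1hol U h -> C1hol U (fun z => g z + h z)%C.
Proof.
  intros [g' Hg] [h' Hh]; exists (fun z => g' z + h' z)%C; intros z Hz.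
  destruct (Hg z Hz), (Hh z Hz); split; [now apply cderiv_plus|now apply ccont_plus].
Qed.

Lemma C1hol_mult U g h : C1hol U g -> C1hol U h -> C1hol U (fun z => g z * h z)%C.
Proof.
  intros Cg Ch.
  assert (Kg := fun z => C1hol_ccont U g z Cg); assert (Kh := fun z => C1hol_ccont U h z Ch).
  destruct Cg as [g' Hg], Ch as [h' Hh].
  exists (fun z => g' z * h z + g z * h' z)%C; intros z Hz.
  destruct (Hg z Hz), (Hh z Hz); split.
  - apply cderiv_mult; auto using ccont_id.
  - apply ccont_plus; apply ccont_mult; auto.
Qed.

Lemma C1hol_opp U g : C1hol U g -> C1hol U (fun z => - g z)%C.
Proof.
  intros [g' Hg]; exists (fun z => - g' z)%C; intros z Hz.
  destruct (Hg z Hz); split; [now apply cderiv_opp|now apply ccont_opp].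
Qed.

Lemma C1hol_minus U g h : C1hol U g -> C1hol U h -> C1hol U (fun z => g z - h z)%C.
Proof. intros; apply C1hol_plus, C1hol_opp; auto. Qed.

Lemma C1hol_comp (U V : C -> Prop) g h :
  C1hol V g -> C1hol U h -> (forall z, U z -> V (h z)) -> C1hol U (fun z => g (h z)).
Proof.
  intros [g' Hg] Ch HUV.
  assert (Kh := fun z => C1hol_ccont U h z Ch).
  destruct Ch as [h' Hh].
  exists (fun z => g' (h z) * h' z)%C; intros z Hz.
  destruct (Hg (h z) (HUV z Hz)), (Hh z Hz); split.
  - apply cderiv_comp; auto using ccont_id.
  - apply ccont_mult; auto. apply (continuous_comp h g'); auto.
Qed.

Lemma C1hol_inv U g :
  C1hol U g -> (forall z, U z -> g z <> RtoC 0) -> C1hol U (fun z => / g z)%C.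
Proof.
  intros Cg H0.
  assert (Kg := fun z => C1hol_ccont U g z Cg).
  destruct Cg as [g' Hg].
  exists (fun z => - g' z / (g z * g z))%C; intros z Hz; destruct (Hg z Hz); split.
  - apply cderiv_inv; auto using ccont_id.
  - apply ccont_div; [now apply ccont_opp|apply ccont_mult; auto|].
    apply Cmult_neq_0; auto.
Qed.

Lemma C1hol_div U g h :
  C1hol U g -> C1hol U h -> (forall z, U z -> h z <> RtoC 0) ->
  C1hol U (fun z => g z / h z)%C.
Proof. intros; apply C1hol_mult, C1hol_inv; auto. Qed.

Definition circle (r t : R) : C := (r * cos t, r * sin t).
(** The density of Cauchy's formula for the point [z] inside the circle of
    radius [r], with respect to the angle. *)
Definition circle_kernel (r : R) (z : C) (t : R) : C := (circle r t / (circle r t - z))%C.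

Lemma Cmod_circle r t : 0 <= r -> Cmod (circle r t) = r.
Proof.
  intros Hr; unfold Cmod, circle; simpl.
  replace (r * cos t * (r * cos t * 1) + r * sin t * (r * sin t * 1))
    with (r * r * (Rsqr (sin t) + Rsqr (cos t))) by (unfold Rsqr; ring).
  rewrite sin2_cos2, Rmult_1_r; now apply sqrt_square.
Qed.

Lemma Cmod_minus_sym (a b : C) : Cmod (a - b) = Cmod (b - a).
Proof. rewrite <- Cmod_opp; f_equal; ring. Qed.

Lemma Cmod_triangle_rev (a b : C) : Cmod a - Cmod b <= Cmod (a - b).
Proof.
  assert (H := Cmod_triangle (a - b) b).
  replace (a - b + b)%C with a in H by ring; lra.
Qed.

Lemma Cmod_triangle_minus (a b : C) : Cmod (a - b) <= Cmod a + Cmod b.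
Proof. rewrite <- (Cmod_opp b); apply Cmod_triangle. Qed.

Lemma circle_neq r z t : Cmod z < r -> (circle r t - z)%C <> RtoC 0.
Proof.
  intros Hz; apply Cmod_gt_0.
  assert (H := Cmod_triangle_rev (circle r t) z).
  rewrite Cmod_circle in H; generalize (Cmod_ge_0 z); lra.
Qed.

Lemma rderiv_circle r t : rderiv (circle r) t (Ci * circle r t)%C.
Proof.
  replace (Ci * circle r t)%C with ((- (r * sin t), r * cos t) : C)
    by (unfold circle, Cmult; simpl; f_equal; ring).
  apply is_derive_rderiv; auto_derive; auto; ring.
Qed.

Lemma ccont_circle r t : ccont (circle r) t.
Proof. apply cderiv_ccont with (2 := rderiv_circle r t), ccont_of_R. Qed.

Lemma ccont_circle_kernel r z t : Cmod z < r -> ccont (circle_kernel r z) t.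
Proof.
  intros Hz; apply ccont_div; [| |now apply circle_neq].
  - apply ccont_circle.
  - apply ccont_minus; [apply ccont_circle|apply ccont_const].
Qed.

Lemma Cmod_circle_kernel_le r z t : Cmod z < r -> Cmod (circle_kernel r z t) <= r / (r - Cmod z).
Proof.
  intros Hz; unfold circle_kernel; generalize (Cmod_ge_0 z); intros Hz0.
  rewrite Cmod_div by now apply circle_neq.
  rewrite Cmod_circle by lra.
  unfold Rdiv; apply Rmult_le_compat_l; [lra|].
  apply Rinv_le_contravar; [lra|].
  rewrite <- (Cmod_circle r t) at 1 by lra. apply Cmod_triangle_rev.
Qed.

(** The value at the centre is ignored, so that difference quotients and other
    functions with a removable singularity at [z] can be used as they stand. *)
Definition tends_to (G : C -> C) (z L : C) :=
  forall e, 0 < e -> exists d, 0 < d /\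
    forall w, w <> z -> Cmod (w - z) < d -> Cmod (G w - L) < e.

Lemma continuous_Re_R {T : UniformSpace} (g : T -> C) t :
  ccont g t -> continuous (fun s => Re (g s)) t.
Proof. intros H; now apply ccont_iff in H. Qed.

Lemma ex_RInt_Re (g : R -> C) (a b : R) :
  (forall t, ccont g t) -> ex_RInt (fun t => Re (g t)) a b.
Proof.
  intros H; apply (ex_RInt_continuous (V := R_CompleteNormedModule)).
  intros t _; now apply continuous_Re_R.
Qed.

(** The circles of the deformation stay in the domain slightly beyond the
    parameter 1, so that the integral is differentiable at 1 as well. *)
Lemma Cmod_segment_circle r R0 z s t :
  Cmod z < r -> r < R0 -> 0 < s < 1 + (R0 - r) / (2 * r) ->
  Cmod (z + s * (circle r t - z)) < R0.
Proof.
  intros Hz Hr Hs; generalize (Cmod_ge_0 z); intros Hz0.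
  destruct (Rle_dec s 1) as [H1|H1].
  - replace (z + s * (circle r t - z))%C with (RtoC (1 - s) * z + RtoC s * circle r t)%C
      by (rewrite RtoC_minus; ring).
    apply Rle_lt_trans with (1 := Cmod_triangle _ _).
    rewrite !Cmod_mult, !Cmod_R, Cmod_circle by lra.
    rewrite !Rabs_pos_eq by lra. nra.
  - replace (z + s * (circle r t - z))%C with (circle r t + RtoC (s - 1) * (circle r t - z))%C
      by (rewrite RtoC_minus; ring).
    apply Rle_lt_trans with (1 := Cmod_triangle _ _).
    rewrite !Cmod_mult, !Cmod_R, Cmod_circle by lra.
    rewrite !Rabs_pos_eq by lra.
    assert (H := Cmod_triangle_minus (circle r t) z); rewrite Cmod_circle in H by lra.
    assert (H2 : (s - 1) * (2 * r) < R0 - r).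
    { apply Rlt_div_r; lra. }
    nra.
Qed.

Section Deformation.
Context (H H' : C -> C) (r R0 : R) (z : C).
Context (Hz : Cmod z < r) (Hr : r < R0).
Context (HH : forall w, Cmod w < R0 -> w <> z -> zderiv H w (H' w) /\ ccont H' w).
Context (Hlim : tends_to H z 0).

Let W (s t : R) : C := (z + s * (circle r t - z))%C.

Let smax := 1 + (R0 - r) / (2 * r).

Let W_good s t : 0 < s < smax -> Cmod (W s t) < R0 /\ W s t <> z.
Proof.
  intros Hs; split; [now apply Cmod_segment_circle|].
  unfold W; intros E.
  assert (E' : (s * (circle r t - z))%C = RtoC 0).
  { replace (s * (circle r t - z))%C with (z + s * (circle r t - z) - z)%C by ring.
    rewrite E; ring. }
  revert E'; apply Cmult_neq_0; [|now apply circle_neq].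
  intros E'; apply RtoC_inj in E'; lra.
Qed.

Let W_ccont (p : R * R) : ccont (fun p : R * R => W (fst p) (snd p)) p.
Proof.
  destruct p as [s t]; apply ccont_plus; [apply ccont_const|].
  apply ccont_mult; [|apply ccont_minus; [|apply ccont_const]].
  - apply ccont_RtoC, continuous_fst.
  - apply (continuous_comp snd (circle r)); [apply continuous_snd|apply ccont_circle].
Qed.

Let W_ds s t : rderiv (fun s => W s t) s (circle r t - z)%C.
Proof.
  replace (circle r t - z)%C with (0 + (circle r t - z) * 1)%C by ring.
  apply cderiv_plus; [apply cderiv_const|].
  apply cderiv_ext with (fun s => ((circle r t - z) * RtoC s)%C); [intros; ring|].
  apply cderiv_scal, cderiv_iota.
Qed.

Let W_dt s t : rderiv (fun t => W s t) t (s * (Ci * circle r t))%C.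
Proof.
  replace (s * (Ci * circle r t))%C with (0 + s * (Ci * circle r t - 0))%C by ring.
  apply cderiv_plus; [apply cderiv_const|].
  apply cderiv_scal, cderiv_minus; [apply rderiv_circle|apply cderiv_const].
Qed.

Let F (s t : R) := Re (H (W s t) * circle_kernel r z t)%C.

Let F_ds s t : 0 < s < smax -> is_derive (fun s => F s t) s (Re (H' (W s t) * circle r t)%C).
Proof.
  intros Hs; destruct (W_good s t Hs) as [G1 G2].
  apply rderiv_Re.
  replace (H' (W s t) * circle r t)%C with (circle_kernel r z t * (H' (W s t) * (circle r t - z)))%C
    by (unfold circle_kernel; field; now apply circle_neq).
  apply cderiv_ext with (fun s => (circle_kernel r z t * H (W s t))%C); [intros; ring|].
  apply cderiv_scal.
  apply (cderiv_comp RtoC H (fun s => W s t)); [apply ccont_of_R| |apply W_ds].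
  now apply HH.
Qed.

Let F_cont s t : 0 < s < smax -> ccont (fun t => H (W s t) * circle_kernel r z t)%C t.
Proof.
  intros Hs; apply ccont_mult; [|now apply ccont_circle_kernel].
  destruct (W_good s t Hs) as [G1 G2].
  apply (continuous_comp (fun t => W s t) H).
  - apply cderiv_ccont with (2 := W_dt s t), ccont_of_R.
  - apply cderiv_ccont with (iota := fun w => w) (d := H' (W s t)); [apply ccont_id|].
    now apply HH.
Qed.

Let F_ds_int s : 0 < s < smax ->
  is_RInt (fun t => Re (H' (W s t) * circle r t)%C) 0 (2 * PI) 0.
Proof.
  intros Hs.
  assert (D : forall t, is_derive (fun t => / s * Im (H (W s t))) t
                          (Re (H' (W s t) * circle r t)%C)).
  { intros t; destruct (W_good s t Hs) as [G1 G2].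
    replace (Re (H' (W s t) * circle r t)%C)
      with (/ s * Im (H' (W s t) * (s * (Ci * circle r t)))%C)
      by (unfold Im, Re; simpl; field; lra).
    apply (is_derive_scal (fun t => Im (H (W s t)))), rderiv_Im.
    apply (cderiv_comp RtoC H (fun t => W s t)); [apply ccont_of_R| |apply W_dt].
    now apply HH. }
  replace 0 with (minus (/ s * Im (H (W s (2 * PI)))) (/ s * Im (H (W s 0)))) at 2.
  - apply (is_RInt_derive (V := R_CompleteNormedModule) (fun t => / s * Im (H (W s t)))); intros t _; auto.
    destruct (W_good s t Hs) as [G1 G2].
    apply continuous_Re_R, ccont_mult; [|apply ccont_circle].
    apply (continuous_comp (fun t => W s t) H').
    + apply cderiv_ccont with (2 := W_dt s t), ccont_of_R.
    + now apply HH.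
  - assert (E : W s (2 * PI) = W s 0).
    { unfold W, circle; now rewrite cos_2PI, sin_2PI, cos_0, sin_0. }
    rewrite E; unfold minus, plus, opp; simpl; ring.
Qed.

Let I s := RInt (F s) 0 (2 * PI).

Let smax_gt1 : 1 < smax.
Proof.
  generalize (Cmod_ge_0 z); intros.
  assert (0 < (R0 - r) / (2 * r)) by (apply Rdiv_lt_0_compat; lra).
  unfold smax; lra.
Qed.

Let I_derive s : 0 < s < smax -> is_derive I s 0.
Proof.
  intros Hs.
  assert (L : locally s (fun u => 0 < u < smax)).
  { apply filter_and; [now apply (open_gt 0)|now apply (open_lt smax)]. }
  replace 0 with (RInt (fun t => Derive (fun u => F u t) s) 0 (2 * PI)).
  - apply (is_derive_RInt_param (fun s t => F s t)).
    + apply filter_imp with (2 := L); intros u Hu t _.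
      eexists; apply F_ds, Hu.
    + intros t _.
      apply continuity_2d_pt_ext_loc with (fun u v => Re (H' (W u v) * circle r v)%C).
      * assert (M : 0 < Rmin s (smax - s)) by (apply Rmin_glb_lt; lra).
        exists (mkposreal _ M); simpl; intros u v Hu _.
        symmetry; apply is_derive_unique, F_ds.
        apply Rabs_lt_between in Hu.
        generalize (Rmin_l s (smax - s)), (Rmin_r s (smax - s)); lra.
      * apply continuity_2d_pt_filterlim.
        change (continuous (fun p : R * R => Re (H' (W (fst p) (snd p)) * circle r (snd p))%C) (s, t)).
        apply continuous_Re_R, ccont_mult.
        -- apply (continuous_comp (fun p : R * R => W (fst p) (snd p)) H'); [apply W_ccont|].
           destruct (W_good s t Hs) as [G1 G2]. now apply HH.
        -- apply (continuous_comp snd (circle r)); [apply continuous_snd|apply ccont_circle].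
    + apply filter_imp with (2 := L); intros u Hu.
      apply ex_RInt_Re; intros t; now apply F_cont.
  - rewrite (RInt_ext _ (fun t => Re (H' (W s t) * circle r t)%C)).
    + now apply is_RInt_unique, F_ds_int.
    + intros t _; now apply is_derive_unique, F_ds.
Qed.

(** Move the circle to [z] along [W s t] = [z + s (circle r t - z)]. The kernel is
    chosen so that the derivative in [s] of the integrand is the derivative in
    [t] of the periodic function Im H (W s t) / s; hence the integral does not
    depend on [s]. It tends to 0 with [s] because [H] does so at [z]. *)
Lemma deformation_aux : RInt (fun t => Re (H (circle r t) * circle_kernel r z t)%C) 0 (2 * PI) = 0.
Proof.
  generalize (Cmod_ge_0 z); intros Hz0.
  rewrite (RInt_ext _ (F 1)).
  2: { intros t _; unfold F, W; now replace (z + 1 * (circle r t - z))%C with (circle r t) by ring. }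
  change (I 1 = 0).
  destruct (Req_dec_T (I 1) 0) as [|n]; auto; exfalso.
  assert (n' := Rabs_pos_lt _ n).
  set (K := 2 * PI * (r / (r - Cmod z))).
  assert (K0 : 0 < K).
  { generalize PI_RGT_0; intros; apply Rmult_lt_0_compat; [lra|].
    apply Rdiv_lt_0_compat; lra. }
  destruct (Hlim (Rabs (I 1) / (2 * K))) as [d [Hd HL]].
  { apply Rdiv_lt_0_compat; lra. }
  set (s := Rmin 1 (d / (4 * r))).
  assert (Hs : 0 < s <= 1).
  { split; [|apply Rmin_l].
    apply Rmin_glb_lt; [lra|apply Rdiv_lt_0_compat; lra]. }
  assert (Hs2 : s * (2 * r) < d).
  { apply Rle_lt_trans with (d / (4 * r) * (2 * r)).
    - apply Rmult_le_compat_r; [lra|apply Rmin_r].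
    - replace (d / (4 * r) * (2 * r)) with (d / 2) by (field; lra); lra. }
  assert (E : I 1 = I s).
  { destruct (MVT_gen I s 1 (fun _ => 0)) as [c [_ Hc]]; [| |lra].
    - intros x; rewrite Rmin_left, Rmax_right by lra; intros; apply I_derive; lra.
    - intros x; rewrite Rmin_left, Rmax_right by lra; intros.
      apply continuity_pt_filterlim.
      apply (ex_derive_continuous I); eexists; apply I_derive; lra. }
  assert (B : Rabs (I s) <= (2 * PI - 0) * (Rabs (I 1) / (2 * K) * (r / (r - Cmod z)))).
  { generalize PI_RGT_0; intros; unfold I; apply abs_RInt_le_const; [lra| |].
    - apply ex_RInt_Re; intros t; apply F_cont; lra.
    - intros t _; unfold F.
      apply Rle_trans with (1 := re_le_Cmod _).
      rewrite Cmod_mult.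
      apply Rmult_le_compat; try apply Cmod_ge_0; [|now apply Cmod_circle_kernel_le].
      left; replace (H (W s t)) with (H (W s t) - 0)%C by ring.
      apply HL; [apply W_good; lra|].
      unfold W; replace (z + s * (circle r t - z) - z)%C with (s * (circle r t - z))%C by ring.
      rewrite Cmod_mult, Cmod_R, Rabs_pos_eq by lra.
      apply Rle_lt_trans with (2 := Hs2), Rmult_le_compat_l; [lra|].
      apply Rle_trans with (1 := Cmod_triangle_minus _ _).
      rewrite Cmod_circle; lra. }
  replace ((2 * PI - 0) * (Rabs (I 1) / (2 * K) * (r / (r - Cmod z))))
    with (Rabs (I 1) / (2 * K) * K) in B by (replace (2 * PI - 0) with (2 * PI) by ring; unfold K at 2; ring).
  rewrite <- E in B.
  replace (Rabs (I 1) / (2 * K) * K) with (Rabs (I 1) / 2) in B by (field; lra).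
  lra.
Qed.
End Deformation.

Lemma deformation (G : C -> C) (L z : C) (r R0 : R) :
  Cmod z < r -> r < R0 ->
  C1hol (fun w => Cmod w < R0 /\ w <> z) G -> tends_to G z L ->
  RInt (fun t => Re ((G (circle r t) - L) * circle_kernel r z t)%C) 0 (2 * PI) = 0.
Proof.
  intros Hz Hr [G' HG] HL.
  apply (deformation_aux (fun w => G w - L)%C G' r R0); auto.
  - intros w H1 H2; destruct (HG w) as [D K]; auto; split; auto.
    replace (G' w) with (G' w - 0)%C by ring.
    apply cderiv_minus; auto using cderiv_const.
  - intros e He; destruct (HL e He) as [d [Hd H]]; exists d; split; auto.
    intros w H1 H2; replace (G w - L - 0)%C with (G w - L)%C by ring; auto.
Qed.

(** * Mean values and the equality case of the Schwarz lemma *)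

Lemma tends_to_ccont (G : C -> C) (z : C) : ccont G z -> tends_to G z (G z).
Proof.
  intros H e He. apply ccont_eps with (2 := He) in H as H'.
  apply locally_Cmod in H'; destruct H' as [d [Hd HP]]; exists d; auto.
Qed.

Lemma tends_to_scal (G : C -> C) (c z L : C) :
  tends_to G z L -> tends_to (fun w => c * G w)%C z (c * L)%C.
Proof.
  intros H e He.
  assert (Hc := Cmod_ge_0 c).
  destruct (H (e / (Cmod c + 1))) as [d [Hd HP]].
  { apply Rdiv_lt_0_compat; lra. }
  exists d; split; auto; intros w H1 H2.
  replace (c * G w - c * L)%C with (c * (G w - L))%C by ring.
  rewrite Cmod_mult.
  assert (H3 := HP w H1 H2).
  apply Rle_lt_trans with (Cmod c * (e / (Cmod c + 1))).
  - apply Rmult_le_compat_l; lra.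
  - replace (Cmod c * (e / (Cmod c + 1))) with (e * (Cmod c / (Cmod c + 1))) by (field; lra).
    assert (Cmod c / (Cmod c + 1) < 1) by (apply Rlt_div_l; lra).
    nra.
Qed.

Lemma circle_ccont_comp (U : C -> Prop) G r t :
  C1hol U G -> U (circle r t) -> ccont (fun t => G (circle r t)) t.
Proof.
  intros HG HU. apply (continuous_comp (circle r) G); [apply ccont_circle|].
  now apply C1hol_ccont with (1 := HG).
Qed.

Lemma circle_neq_0 r t : 0 < r -> circle r t <> RtoC 0.
Proof.
  intros Hr E; assert (H := Cmod_circle r t (Rlt_le _ _ Hr)).
  rewrite E, Cmod_0 in H; lra.
Qed.

Lemma mean_value (G : C -> C) (L : C) (r R0 : R) :
  0 < r -> r < R0 ->
  C1hol (fun w => Cmod w < R0 /\ w <> RtoC 0) G -> tends_to G 0 L ->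
  is_RInt (fun t => Re (G (circle r t))) 0 (2 * PI) (2 * PI * Re L).
Proof.
  intros Hr HR HG HL.
  assert (Hc : forall t, ccont (fun t => G (circle r t)) t).
  { intros t; apply circle_ccont_comp with (1 := HG); split.
    - rewrite Cmod_circle; lra.
    - now apply circle_neq_0. }
  assert (H0 : Cmod 0 < r) by now rewrite Cmod_0.
  assert (H := deformation G L 0 r R0 H0 HR HG HL).
  assert (E := RInt_correct _ _ _ (ex_RInt_Re (fun t => G (circle r t)) 0 (2 * PI) Hc)).
  replace (2 * PI * Re L) with (RInt (fun t => Re (G (circle r t))) 0 (2 * PI)); auto.
  rewrite (RInt_ext _ (fun t => minus (Re (G (circle r t))) (Re L))) in H.
  2: { intros t _; unfold circle_kernel.
       replace (circle r t / (circle r t - 0))%C with (RtoC 1).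
       - unfold minus, plus, opp, Re; simpl; ring.
       - field; replace (circle r t - 0)%C with (circle r t) by ring; now apply circle_neq_0. }
  rewrite (RInt_minus (V := R_CompleteNormedModule)) in H.
  - rewrite RInt_const in H.
    unfold minus, plus, opp, scal in H; simpl in H; unfold mult in H; simpl in H; lra.
  - now exists (RInt (fun t => Re (G (circle r t))) 0 (2 * PI)).
  - apply ex_RInt_const.
Qed.

(** Positivity of the real part replaces the exact value of the integral of the
    kernel: a lower bound suffices for the estimates below. *)
Lemma Re_circle_kernel_ge r z t : Cmod z < r ->
  r * (r - Cmod z) / (r + Cmod z) ^ 2 <= Re (circle_kernel r z t).
Proof.
  intros Hz; assert (Hz0 := Cmod_ge_0 z).
  assert (Hn := circle_neq r z t Hz).
  set (c := circle r t) in *.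
  assert (Hc : Cmod c = r) by (apply Cmod_circle; lra).
  assert (E : Re (circle_kernel r z t) = Re (c * Cconj (c - z))%C / Cmod (c - z) ^ 2).
  { assert (E1 : circle_kernel r z t = (RtoC (/ Cmod (c - z) ^ 2) * (c * Cconj (c - z)))%C).
    { unfold circle_kernel; fold c. apply Cmod_gt_0 in Hn as Hn'.
      rewrite RtoC_inv by (apply pow_nonzero; lra).
      rewrite Cmod2_conj; field; split; auto.
      intros E; apply (f_equal Cmod) in E; rewrite Cmod_conj, Cmod_0 in E; lra. }
    rewrite E1, re_scal_l; unfold Rdiv; ring. }
  rewrite E.
  apply Cmod_gt_0 in Hn.
  assert (H1 : Cmod (c - z) <= r + Cmod z).
  { rewrite <- Hc; apply Cmod_triangle_minus. }
  assert (H2 : r * (r - Cmod z) <= Re (c * Cconj (c - z))%C).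
  { replace (Re (c * Cconj (c - z))%C) with (r ^ 2 - Re (c * Cconj z)%C).
    - assert (H := Rle_abs (Re (c * Cconj z)%C)).
      assert (H' := re_le_Cmod (c * Cconj z)%C).
      rewrite Cmod_mult, Cmod_conj, Hc in H'. nra.
    - rewrite <- Hc, Cmod2_alt; unfold Re, Im; simpl; ring. }
  apply Rmult_le_compat; auto.
  - apply Rmult_le_pos; lra.
  - left; apply Rinv_0_lt_compat, pow_lt; lra.
  - apply Rinv_le_contravar; [now apply pow_lt|].
    apply pow_incr; lra.
Qed.

(** Normalise so that the limit [L] is real and nonnegative; then the integral of
    the real part of [L] times the kernel is bounded below, and by [deformation] it
    equals the integral of the real part of [G] times the kernel. *)
Lemma point_bound (G : C -> C) (z L : C) (r R0 : R) :
  Cmod z < r -> r < R0 ->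
  C1hol (fun w => Cmod w < R0 /\ w <> z) G -> tends_to G z L ->
  2 * PI * Cmod L <=
  ((r + Cmod z) / (r - Cmod z)) ^ 2 * RInt (fun t => Cmod (G (circle r t))) 0 (2 * PI).
Proof.
  intros Hz HR HG HL; assert (Hz0 := Cmod_ge_0 z).
  assert (P := PI_RGT_0).
  set (u := Cconj L); set (g := Cmod L).
  assert (Hg0 : 0 <= g) by apply Cmod_ge_0.
  assert (Hu : (u * L)%C = RtoC (g ^ 2)).
  { unfold g; rewrite Cmod2_conj; unfold u; ring. }
  assert (Hc : forall t, ccont (fun t => G (circle r t)) t).
  { intros t; apply circle_ccont_comp with (1 := HG); split.
    - rewrite Cmod_circle; lra.
    - intros E; apply (circle_neq r z t Hz); rewrite E; ring. }
  assert (H : RInt (fun t => Re ((u * G (circle r t) - g ^ 2) * circle_kernel r z t)%C) 0 (2 * PI) = 0).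
  { apply (deformation (fun w => u * G w)%C (g ^ 2) z r R0); auto.
    - apply C1hol_mult; [apply C1hol_const|auto].
    - rewrite <- RtoC_pow, <- Hu. now apply tends_to_scal. }
  set (k := r * (r - Cmod z) / (r + Cmod z) ^ 2).
  set (k' := r / (r - Cmod z)).
  assert (IC : ex_RInt (fun t => Cmod (G (circle r t))) 0 (2 * PI)).
  { apply (ex_RInt_continuous (V := R_CompleteNormedModule)); intros t _.
    apply continuous_Cmod, Hc. }
  assert (J : is_RInt (fun t => minus (scal (g * k') (Cmod (G (circle r t)))) (g ^ 2 * k)) 0 (2 * PI)
    (minus (scal (g * k') (RInt (fun t => Cmod (G (circle r t))) 0 (2 * PI)))
       (scal (2 * PI - 0) (g ^ 2 * k)))).
  { apply (is_RInt_minus (V := R_NormedModule)); [|apply (is_RInt_const (V := R_NormedModule))].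
    apply (is_RInt_scal (V := R_NormedModule)).
    now apply (RInt_correct (V := R_CompleteNormedModule)). }
  set (RI := RInt (fun t => Cmod (G (circle r t))) 0 (2 * PI)) in *.
  assert (D : 0 <= g * k' * RI - (2 * PI - 0) * (g ^ 2 * k)).
  { rewrite <- H at 1.
    apply is_RInt_le with (3 := J) (a := 0) (b := 2 * PI)
     (f := fun t => Re ((u * G (circle r t) - g ^ 2) * circle_kernel r z t)%C); [lra| |].
    - apply (RInt_correct (V := R_CompleteNormedModule)), ex_RInt_Re; intros t.
      apply ccont_mult; [|now apply ccont_circle_kernel].
      apply ccont_minus, ccont_const; apply ccont_mult; auto using ccont_const.
    - intros t _.
      replace (Re ((u * G (circle r t) - g ^ 2) * circle_kernel r z t)%C)
        with (Re (u * G (circle r t) * circle_kernel r z t)%C - g ^ 2 * Re (circle_kernel r z t)).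
      2: { rewrite <- RtoC_pow; unfold Re; simpl; ring. }
      apply Rplus_le_compat; [|apply Ropp_le_contravar, Rmult_le_compat_l].
      + apply Rle_trans with (1 := Rle_abs _), Rle_trans with (1 := re_le_Cmod _).
        unfold scal; simpl; unfold mult; simpl.
        rewrite !Cmod_mult; unfold u; rewrite Cmod_conj; fold g.
        replace (g * k' * Cmod (G (circle r t))) with (g * Cmod (G (circle r t)) * k') by ring.
        apply Rmult_le_compat_l; [|now apply Cmod_circle_kernel_le].
        apply Rmult_le_pos; auto using Cmod_ge_0.
      + apply pow2_ge_0.
      + now apply Re_circle_kernel_ge. }
  assert (RI0 : 0 <= RI).
  { apply (RInt_ge_0 (fun t => Cmod (G (circle r t)))); auto; [lra|]; intros; apply Cmod_ge_0. }
  destruct Hg0 as [Hg0|Hg0].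
  2: { rewrite <- Hg0; rewrite Rmult_0_r; apply Rmult_le_pos; auto; apply pow2_ge_0. }
  assert (Hk : 0 < k).
  { unfold k; apply Rdiv_lt_0_compat; [apply Rmult_lt_0_compat; lra|apply pow_lt; lra]. }
  replace (((r + Cmod z) / (r - Cmod z)) ^ 2) with (k' / k)
    by (unfold k, k'; field; repeat split; lra).
  assert (D2 : 2 * PI * g * k <= k' * RI).
  { apply Rmult_le_reg_l with g; auto. lra. }
  apply Rmult_le_reg_r with k; auto.
  replace (k' / k * RI * k) with (k' * RI) by (field; lra). exact D2.
Qed.

Lemma sup_bound (G : C -> C) (z L : C) (r R0 M : R) :
  Cmod z < r -> r < R0 ->
  C1hol (fun w => Cmod w < R0 /\ w <> z) G -> tends_to G z L ->
  (forall t, 0 <= t <= 2 * PI -> Cmod (G (circle r t)) <= M) ->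
  Cmod L <= ((r + Cmod z) / (r - Cmod z)) ^ 2 * M.
Proof.
  intros Hz HR HG HL HM; assert (P := PI_RGT_0); assert (Hz0 := Cmod_ge_0 z).
  apply Rmult_le_reg_l with (2 * PI); [lra|].
  apply Rle_trans with (1 := point_bound G z L r R0 Hz HR HG HL).
  rewrite (Rmult_comm (2 * PI)), Rmult_assoc.
  apply Rmult_le_compat_l; [apply pow2_ge_0|].
  replace (M * (2 * PI)) with (RInt (fun _ => M) 0 (2 * PI)).
  2: { rewrite RInt_const; unfold scal; simpl; unfold mult; simpl; ring. }
  apply RInt_le; [lra| |apply ex_RInt_const|intros; apply HM; lra].
  apply (ex_RInt_continuous (V := R_CompleteNormedModule)); intros t _.
  apply continuous_Cmod, (circle_ccont_comp _ _ _ _ HG); split.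
  - rewrite Cmod_circle; lra.
  - intros E; apply (circle_neq r z t Hz); rewrite E; ring.
Qed.

Lemma tends_to_div_id (psi : C -> C) (k : C) :
  zderiv psi (RtoC 0) k -> psi (RtoC 0) = RtoC 0 -> tends_to (fun w => psi w / w)%C 0 k.
Proof.
  intros [q [Hq [Hd Hl]]] H0 e He.
  apply ccont_eps with (2 := He) in Hq.
  assert (H := filter_and _ _ Hq Hl).
  apply locally_Cmod in H; destruct H as [d [Hd' HP]].
  exists d; split; auto; intros w H1 H2.
  destruct (HP w H2) as [H3 H4].
  rewrite H4, H0, <- Hd.
  replace ((0 + q w * (w - 0)) / w)%C with (q w) by (field; auto); auto.
Qed.

(** Let [K] = [psi w / w]. Its mean over every circle about 0 is [k], of modulus
    1, while |K| <= 1/r on the circle of radius r; so the mean of |K - k|^2 is at most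
    1/r^2 - 1. Thus [psi w - k w] is small in mean square near the boundary, and
    [point_bound] applied to its square carries this to interior points. *)
Lemma schwarz_equality (psi : C -> C) (k : C) :
  C1hol in_disk psi -> (forall z, in_disk z -> Cmod (psi z) <= 1) ->
  psi (RtoC 0) = RtoC 0 -> zderiv psi (RtoC 0) k -> Cmod k = 1 ->
  forall z, in_disk z -> psi z = (k * z)%C.
Proof.
  unfold in_disk; intros Hpsi Hle H0 Hk Hk1 z Hz.
  assert (P := PI_RGT_0); assert (Hz0 := Cmod_ge_0 z).
  set (G := fun w : C => ((psi w - k * w) * (psi w - k * w))%C).
  assert (HG : C1hol (fun w => Cmod w < 1) G).
  { assert (HG : C1hol (fun w => Cmod w < 1) (fun w => psi w - k * w)%C).
    { apply C1hol_minus; auto. apply C1hol_mult; [apply C1hol_const|apply C1hol_id]. }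
    now apply C1hol_mult. }
  (* The lower bound on [r] keeps the kernel factor at most 16 / (1 - |z|)^2, uniformly as r tends to 1. *)
  assert (Key : forall r, (1 + Cmod z) / 2 <= r < 1 ->
    Cmod (G z) <= 32 / (1 - Cmod z) ^ 2 * (1 - r)).
  { intros r Hr.
    assert (B := point_bound G z (G z) r 1 ltac:(lra) ltac:(lra)
      (C1hol_sub (fun w => Cmod w < 1 /\ w <> z) _ _ HG ltac:(tauto)) (tends_to_ccont _ _ (C1hol_ccont _ _ _ HG Hz))).
    assert (MV := mean_value (fun w => Cconj k * (psi w / w))%C (Cconj k * k)%C r 1
      ltac:(lra) ltac:(lra)).
    replace (Re (Cconj k * k)) with 1 in MV.
    2: { assert (E := Cmod2_alt k); rewrite Hk1 in E; unfold Re, Im in *; simpl in *; lra. }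
    assert (MV' : is_RInt (fun t => Re (Cconj k * (psi (circle r t) / circle r t))) 0 (2 * PI) (2 * PI * 1)).
    { apply MV.
      - apply C1hol_mult; [apply C1hol_const|].
        apply C1hol_div; [|apply C1hol_id|tauto].
        apply C1hol_sub with (1 := Hpsi); tauto.
      - now apply tends_to_scal, tends_to_div_id. }
    clear MV.
    assert (J : is_RInt (fun t => minus (1 + r ^ 2)
        (scal (2 * r ^ 2) (Re (Cconj k * (psi (circle r t) / circle r t))))) 0 (2 * PI)
      (minus (scal (2 * PI - 0) (1 + r ^ 2)) (scal (2 * r ^ 2) (2 * PI * 1)))).
    { apply (is_RInt_minus (V := R_NormedModule)); [apply (is_RInt_const (V := R_NormedModule))|].
      now apply (is_RInt_scal (V := R_NormedModule)). }
    set (RI := RInt (fun t => Cmod (G (circle r t))) 0 (2 * PI)) in *.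
    assert (D : RI <= (2 * PI - 0) * (1 + r ^ 2) - (2 * r ^ 2) * (2 * PI * 1)).
    { apply is_RInt_le with (3 := J) (a := 0) (b := 2 * PI)
       (f := fun t => Cmod (G (circle r t))); [lra| |].
      - apply (RInt_correct (V := R_CompleteNormedModule)).
        apply (ex_RInt_continuous (V := R_CompleteNormedModule)); intros t _.
        apply continuous_Cmod, (circle_ccont_comp _ _ _ _ HG).
        rewrite Cmod_circle; lra.
      - intros t _.
        set (c := circle r t).
        assert (Hc : Cmod c = r) by (apply Cmod_circle; lra).
        assert (Hc0 : c <> RtoC 0) by (apply circle_neq_0; lra).
        unfold G; rewrite Cmod_mult.
        assert (Hp : Cmod (psi c) <= 1) by (apply Hle; lra).
        assert (Hp0 := Cmod_ge_0 (psi c)).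
        change (Cmod (psi c - k * c) * Cmod (psi c - k * c)
          <= 1 + r ^ 2 - 2 * r ^ 2 * Re (Cconj k * (psi c / c))).
        replace (Cmod (psi c - k * c) * Cmod (psi c - k * c))
          with (Cmod (psi c) ^ 2 + Cmod (k * c) ^ 2 - 2 * Re (psi c * Cconj (k * c))%C).
        2: { replace (Cmod (psi c - k * c) * Cmod (psi c - k * c))
               with (Cmod (psi c - k * c) ^ 2) by ring.
             rewrite !Cmod2_alt; unfold Re, Im; simpl; ring. }
        (* On the circle, conj c = r^2 / c turns the cross term into the holomorphic quotient psi c / c, whose mean is known. *)
        replace (psi c * Cconj (k * c))%C with (RtoC (r ^ 2) * (Cconj k * (psi c / c)))%C.
        2: { rewrite <- Hc, Cmod2_conj, Cmult_conj; field; auto. }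
        rewrite re_scal_l, Cmod_mult, Hk1, Hc. nra. }
    clear J MV'.
    set (q := ((r + Cmod z) / (r - Cmod z)) ^ 2) in *.
    assert (Q : q <= 16 / (1 - Cmod z) ^ 2).
    { unfold q.
      replace (16 / (1 - Cmod z) ^ 2) with ((2 / ((1 - Cmod z) / 2)) ^ 2) by (field; lra).
      apply pow_incr; split.
      - apply Rmult_le_pos; [lra|left; apply Rinv_0_lt_compat; lra].
      - apply Rmult_le_compat; [lra|left; apply Rinv_0_lt_compat; lra|lra|].
        apply Rinv_le_contravar; lra. }
    assert (Q0 : 0 <= q) by (unfold q; apply pow2_ge_0).
    assert (S : Cmod (G z) <= q * (1 - r ^ 2)).
    { apply Rmult_le_reg_l with (2 * PI); [lra|].
      apply Rle_trans with (1 := B).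
      replace (2 * PI * (q * (1 - r ^ 2))) with (q * (2 * PI * (1 - r ^ 2))) by ring.
      apply Rmult_le_compat_l; auto. lra. }
    apply Rle_trans with (1 := S).
    replace (32 / (1 - Cmod z) ^ 2 * (1 - r)) with (16 / (1 - Cmod z) ^ 2 * (2 * (1 - r)))
      by (field; lra).
    apply Rmult_le_compat; auto; nra. }
  assert (Z : Cmod (G z) <= 0).
  { apply le_epsilon; intros e He; rewrite Rplus_0_l.
    set (A := 32 / (1 - Cmod z) ^ 2) in *.
    assert (HA : 0 < A) by (apply Rdiv_lt_0_compat; [lra|apply pow_lt; lra]).
    assert (Ed : 0 < Rmin (e / A) ((1 - Cmod z) / 2)).
    { apply Rmin_glb_lt; [apply Rdiv_lt_0_compat; lra|lra]. }
    apply Rle_trans with (1 := Key (1 - Rmin (e / A) ((1 - Cmod z) / 2)) ltac:(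
      generalize (Rmin_r (e / A) ((1 - Cmod z) / 2)); lra)).
    replace (1 - (1 - Rmin (e / A) ((1 - Cmod z) / 2))) with (Rmin (e / A) ((1 - Cmod z) / 2)) by ring.
    replace e with (A * (e / A)) at 2 by (field; lra).
    apply Rmult_le_compat_l; [lra|apply Rmin_l]. }
  assert (Z' : G z = RtoC 0) by (apply Cmod_eq_0; generalize (Cmod_ge_0 (G z)); lra).
  assert (Z2 : (psi z - k * z)%C = RtoC 0).
  { destruct (Ceq_dec (psi z - k * z)%C 0) as [|n]; auto.
    exfalso; revert Z'; now apply Cmult_neq_0. }
  replace (psi z) with (psi z - k * z + k * z)%C by ring. rewrite Z2; ring.
Qed.

(** * Injective holomorphic functions *)

Lemma rderiv_segment (a b : C) (t : R) :
  rderiv (fun s : R => a + s * b)%C t b.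
Proof.
  apply cderiv_eq with (0 + b * 1)%C; [|ring].
  apply cderiv_plus; [apply cderiv_const|].
  apply cderiv_ext with (fun s => (b * RtoC s)%C); [intros; ring|].
  apply cderiv_scal, cderiv_iota.
Qed.

(** The real mean value theorem, applied to the projection of the path on the
    direction of its total increment. *)
Lemma path_increment_le (p p' : R -> C) (M : R) :
  (forall s, 0 <= s <= 1 -> rderiv p s (p' s) /\ Cmod (p' s) <= M) ->
  Cmod (p 1 - p 0) <= M.
Proof.
  intros H.
  set (u := Cconj (p 1 - p 0)).
  set (h := fun s : R => Re (u * p s)%C).
  assert (Dh : forall s, 0 <= s <= 1 -> is_derive h s (Re (u * p' s)%C)).
  { intros s Hs; apply rderiv_Re, cderiv_scal; now apply H. }
  destruct (MVT_gen h 0 1 (fun s => Re (u * p' s)%C)) as [c [Hc E]].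
  - intros x; rewrite Rmin_left, Rmax_right by lra; intros; apply Dh; lra.
  - intros x; rewrite Rmin_left, Rmax_right by lra; intros.
    apply continuity_pt_filterlim, (ex_derive_continuous h); eexists; apply Dh; lra.
  - rewrite Rmin_left, Rmax_right in Hc by lra.
    assert (E1 : h 1 - h 0 = Cmod (p 1 - p 0) ^ 2).
    { unfold h; rewrite Cmod2_alt; unfold u, Re, Im; simpl; ring. }
    assert (E2 := Rle_abs (Re (u * p' c)%C)).
    assert (E3 := re_le_Cmod (u * p' c)%C).
    rewrite Cmod_mult in E3; unfold u in E3 at 2; rewrite Cmod_conj in E3.
    assert (E4 : Cmod (p' c) <= M) by now apply H.
    destruct (Cmod_ge_0 (p 1 - p 0)) as [q|q].
    + apply Rmult_le_reg_l with (1 := q). nra.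
    + rewrite <- q; apply Rle_trans with (2 := E4), Cmod_ge_0.
Qed.

Lemma mean_value_inequality (g g' : C -> C) (z w : C) (M : R) :
  (forall s : R, 0 <= s <= 1 ->
     zderiv g (z + s * (w - z))%C (g' (z + s * (w - z))%C) /\
     Cmod (g' (z + s * (w - z))%C) <= M) ->
  Cmod (g w - g z) <= M * Cmod (w - z).
Proof.
  intros H.
  assert (P := path_increment_le (fun s => g (z + s * (w - z))%C)
    (fun s => g' (z + s * (w - z)) * (w - z))%C (M * Cmod (w - z))).
  cbv beta in P.
  replace (z + 1 * (w - z))%C with w in P by ring.
  replace (z + 0 * (w - z))%C with z in P by ring.
  apply P; intros s Hs; split.
  - apply (cderiv_comp RtoC g (fun s : R => z + s * (w - z))%C);
      [apply ccont_of_R|now apply H|apply rderiv_segment].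
  - rewrite Cmod_mult; apply Rmult_le_compat_r; [apply Cmod_ge_0|now apply H].
Qed.

Lemma in_disk_nbhd z : in_disk z ->
  exists d, 0 < d /\ forall w, Cmod w < d -> in_disk (z + w).
Proof.
  unfold in_disk; intros Hz; exists (1 - Cmod z); split; [lra|]; intros w Hw.
  apply Rle_lt_trans with (1 := Cmod_triangle _ _); lra.
Qed.

Lemma C1hol_translate (U V : C -> Prop) g c :
  C1hol V g -> (forall w, U w -> V (c + w)%C) -> C1hol U (fun w => g (c + w)%C).
Proof.
  intros Hg H; apply (C1hol_comp U V g (fun w => c + w)%C); auto.
  apply C1hol_plus; [apply C1hol_const|apply C1hol_id].
Qed.

Definition injective_on_disk (f : C -> C) :=
  forall z w, in_disk z -> in_disk w -> f z = f w -> z = w.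

Lemma circle_gap (f : C -> C) (z0 : C) (r : R) :
  C1hol in_disk f -> injective_on_disk f -> 0 < r -> in_disk z0 ->
  (forall w, Cmod w <= r -> in_disk (z0 + w)) ->
  exists m, 0 < m /\
    forall t, 0 <= t <= 2 * PI -> m <= Cmod (f (z0 + circle r t)%C - f z0).
Proof.
  intros Hf Hi Hr Hz0 Hd; assert (P := PI_RGT_0).
  assert (Hc : forall t, in_disk (z0 + circle r t)).
  { intros t; apply Hd; rewrite Cmod_circle; lra. }
  destruct (continuous_ab_min_consistent (fun t => Cmod (f (z0 + circle r t)%C - f z0)) 0 (2 * PI))
    as [t0 [H1 H2]]; [lra| |].
  - intros t _; apply continuous_Cmod, ccont_minus; [|apply ccont_const].
    apply (continuous_comp (fun t => z0 + circle r t)%C f).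
    + apply ccont_plus; [apply ccont_const|apply ccont_circle].
    + now apply C1hol_ccont with (1 := Hf).
  - exists (Cmod (f (z0 + circle r t0)%C - f z0)); split; auto.
    apply Cmod_gt_0; intros E.
    assert (E1 : f (z0 + circle r t0)%C = f z0).
    { replace (f (z0 + circle r t0)%C) with (f (z0 + circle r t0) - f z0 + f z0)%C by ring.
      rewrite E; ring. }
    apply Hi in E1; auto.
    apply (circle_neq_0 r t0 Hr).
    replace (circle r t0) with (z0 + circle r t0 - z0)%C by ring. rewrite E1; ring.
Qed.

Lemma Cminus_neq_0 (a b : C) : a <> b -> (a - b)%C <> RtoC 0.
Proof.
  intros H E; apply H; replace a with (a - b + b)%C by ring; rewrite E; ring.
Qed.

(** If the value [v] were omitted near [z0], the maximum principle for 1 / (f - v) on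
    a small circle would contradict that |f - v| is larger on the circle than at
    [z0]; injectivity provides the gap on the circle. *)
Lemma open_mapping (f : C -> C) (z0 : C) (d : R) :
  C1hol in_disk f -> injective_on_disk f -> in_disk z0 -> 0 < d ->
  exists e, 0 < e /\ forall v, Cmod (v - f z0) < e ->
    exists z, in_disk z /\ Cmod (z - z0) < d /\ f z = v.
Proof.
  intros Hf Hi Hz0 Hd.
  destruct (in_disk_nbhd z0 Hz0) as [d1 [Hd1 HD]].
  set (R0 := Rmin d d1).
  assert (HR0 : 0 < R0) by now apply Rmin_glb_lt.
  assert (Rd : R0 <= d) by apply Rmin_l. assert (Rd1 : R0 <= d1) by apply Rmin_r.
  destruct (circle_gap f z0 (R0 / 2) Hf Hi ltac:(lra) Hz0) as [m [Hm Hgap]].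
  { intros w Hw; apply HD; lra. }
  exists (m / 2); split; [lra|]; intros v Hv.
  destruct (excluded_middle_informative
    (exists z, in_disk z /\ Cmod (z - z0) < d /\ f z = v)) as [|N]; auto; exfalso.
  assert (N' : forall w, Cmod w < R0 -> (f (z0 + w) - v)%C <> RtoC 0).
  { intros w Hw; apply Cminus_neq_0; intros E; apply N; exists (z0 + w)%C.
    repeat split; auto; [apply HD; lra|].
    replace (z0 + w - z0)%C with w by ring; lra. }
  assert (HG : C1hol (fun w => Cmod w < R0) (fun w => / (f (z0 + w) - v))%C).
  { apply C1hol_inv; auto. apply C1hol_minus; [|apply C1hol_const].
    apply C1hol_translate with (1 := Hf); intros; apply HD; lra. }
  assert (H0 : Cmod 0 < R0) by now rewrite Cmod_0.
  assert (HG' : C1hol (fun w => Cmod w < R0 /\ w <> RtoC 0) (fun w => / (f (z0 + w) - v))%C)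
    by (apply C1hol_sub with (1 := HG); tauto).
  assert (S := sup_bound (fun w => / (f (z0 + w) - v))%C 0 (/ (f (z0 + 0) - v))%C (R0 / 2) R0
    (/ (m / 2)) ltac:(rewrite Cmod_0; lra) ltac:(lra) HG'
    (tends_to_ccont _ _ (C1hol_ccont _ _ _ HG H0))).
  assert (S' : Cmod (/ (f (z0 + 0)%C - v)) <= / (m / 2)).
  { replace (/ (m / 2)) with (((R0 / 2 + Cmod 0) / (R0 / 2 - Cmod 0)) ^ 2 * / (m / 2))
      by (rewrite Cmod_0; field; lra).
    apply S; intros t Ht.
    rewrite Cmod_inv by (apply N'; rewrite Cmod_circle; lra).
    apply Rinv_le_contravar; [lra|].
    assert (T := Cmod_triangle_rev (f (z0 + circle (R0 / 2) t)%C - f z0) (v - f z0)).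
    assert (T' := Hgap t Ht).
    replace (f (z0 + circle (R0 / 2) t) - f z0 - (v - f z0))%C
      with (f (z0 + circle (R0 / 2) t) - v)%C in T by ring.
    lra. }
  assert (N0 := N' 0 H0).
  rewrite Cmod_inv in S' by auto.
  apply Cmod_gt_0 in N0.
  apply Rinv_le_contravar in S'; [|now apply Rinv_0_lt_compat].
  rewrite !Rinv_inv in S'.
  replace (z0 + 0)%C with z0 in S' by ring.
  rewrite Cmod_minus_sym in S'. lra.
Qed.

(** A Hurwitz argument. For [w] near 0 with nonzero derivative at [z0 + w], the
    quotient [(x - w) / (f (z0 + x) - f (z0 + w))] is holomorphic off [w] by
    injectivity, with limit 1 / f1 (z0 + w) at [w], and it is bounded on a fixed
    circle uniformly in [w]. So [f1] is bounded away from 0 at such points. Were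
    it to vanish at [z0], it would by continuity vanish on a neighbourhood of [z0],
    where [f] would be constant. *)
Lemma injective_derivative_neq_0 (f f1 : C -> C) :
  (forall z, in_disk z -> zderiv f z (f1 z) /\ ccont f1 z) ->
  injective_on_disk f -> forall z0, in_disk z0 -> f1 z0 <> RtoC 0.
Proof.
  intros Hff Hi z0 Hz0 Z.
  assert (Hf : C1hol in_disk f) by now exists f1.
  destruct (in_disk_nbhd z0 Hz0) as [R0 [HR0 HD]].
  set (r := R0 / 2).
  destruct (circle_gap f z0 r Hf Hi ltac:(unfold r; lra) Hz0) as [m [Hm Hgap]].
  { unfold r; intros w Hw; apply HD; lra. }
  set (B := 9 * (2 * r / (m / 2))).
  assert (HB : 0 < B) by (unfold B, r; apply Rmult_lt_0_compat; [lra|apply Rdiv_lt_0_compat; lra]).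
  assert (C0 : ccont f z0) by now apply C1hol_ccont with (1 := Hf).
  assert (C1 : ccont f1 z0) by now apply Hff.
  assert (Hm2 : 0 < m / 2) by lra.
  destruct (proj1 (locally_Cmod z0 _) (filter_and _ _
     (proj1 (ccont_eps f z0) C0 (m / 2) Hm2)
     (proj1 (ccont_eps f1 z0) C1 (/ B) (Rinv_0_lt_compat _ HB)))) as [d [Hd HP]].
  set (d' := Rmin d (r / 2)).
  assert (Hd' : 0 < d') by (apply Rmin_glb_lt; unfold r; lra).
  assert (d' <= d) by apply Rmin_l. assert (d' <= r / 2) by apply Rmin_r.
  assert (Flat : forall w, Cmod w < d' -> f1 (z0 + w)%C = RtoC 0).
  { intros w Hw.
    destruct (Ceq_dec (f1 (z0 + w)%C) 0) as [|n]; auto; exfalso.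
    destruct (HP (z0 + w)%C) as [P1 P2].
    { replace (z0 + w - z0)%C with w by ring; lra. }
    assert (Dw : in_disk (z0 + w)) by (apply HD; unfold r in *; lra).
    assert (NE : forall x, Cmod x < R0 -> x <> w -> (f (z0 + x) - f (z0 + w))%C <> RtoC 0).
    { intros x Hx Hxw; apply Cminus_neq_0; intros E; apply Hxw.
      apply Hi in E; auto.
      replace x with (z0 + x - z0)%C by ring; rewrite E; ring. }
    (* On the circle |x - w| <= 2 r, and the denominator is at least m / 2; the factor 9 bounds ((r + |w|) / (r - |w|))^2 for |w| <= r / 2. *)
    assert (S := sup_bound (fun x => (x - w) / (f (z0 + x) - f (z0 + w)))%C w
      (/ f1 (z0 + w))%C r R0 (2 * r / (m / 2)) ltac:(unfold r in *; lra) ltac:(unfold r; lra)).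
    assert (S' : Cmod (/ f1 (z0 + w)%C) <= ((r + Cmod w) / (r - Cmod w)) ^ 2 * (2 * r / (m / 2))).
    { apply S.
      - apply C1hol_div.
        + apply C1hol_minus; [apply C1hol_id|apply C1hol_const].
        + apply C1hol_minus; [|apply C1hol_const].
          apply C1hol_translate with (1 := Hf); intros x Hx; now apply HD.
        + intros x [Hx1 Hx2]; auto.
      - destruct (proj1 (Hff _ Dw)) as [q [Hq [Eq Hl]]].
        intros e He.
        assert (Hqi : ccont (fun x => / q x)%C (z0 + w)%C).
        { apply ccont_inv; auto. now rewrite Eq. }
        destruct (proj1 (locally_Cmod (z0 + w) _) (filter_and _ _ Hl (filter_and _ _
           (proj1 (ccont_eps _ _) Hqi e He)
           (ccont_neq_locally q 0 (z0 + w)%C Hq ltac:(now rewrite Eq)))))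
          as [d2 [Hd2 HP2]].
        exists d2; split; auto; intros x Hx1 Hx2.
        destruct (HP2 (z0 + x)%C) as [Q1 [Q2 Q3]].
        { replace (z0 + x - (z0 + w))%C with (x - w)%C by ring; auto. }
        replace ((x - w) / (f (z0 + x) - f (z0 + w)))%C with (/ q (z0 + x))%C.
        + rewrite <- Eq; auto.
        + rewrite Q1. field. split; auto.
          replace (f (z0 + w) + q (z0 + x) * (z0 + x - (z0 + w)) - f (z0 + w))%C
            with (q (z0 + x) * (x - w))%C by ring.
          apply Cmult_neq_0; auto. now apply Cminus_neq_0.
      - intros t Ht.
        assert (Hc := Cmod_circle r t ltac:(unfold r; lra)).
        rewrite Cmod_div.
        2: { apply NE; [unfold r in *; lra|]. intros E; rewrite E in Hc.
             unfold r in *; lra. }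
        assert (T1 := Cmod_triangle_minus (circle r t) w).
        assert (T := Cmod_triangle_rev (f (z0 + circle r t)%C - f z0) (f (z0 + w)%C - f z0)).
        assert (T' := Hgap t Ht).
        replace (f (z0 + circle r t) - f z0 - (f (z0 + w) - f z0))%C
          with (f (z0 + circle r t) - f (z0 + w))%C in T by ring.
        unfold Rdiv at 1; apply Rmult_le_compat.
        + apply Cmod_ge_0.
        + left; apply Rinv_0_lt_compat; lra.
        + unfold r in *; lra.
        + apply Rinv_le_contravar; lra. }
    assert (Hw0 := Cmod_ge_0 w).
    assert (K : ((r + Cmod w) / (r - Cmod w)) ^ 2 <= 9).
    { replace 9 with (3 ^ 2) by ring. apply pow_incr; split.
      - apply Rmult_le_pos; [unfold r in *; lra|].
        left; apply Rinv_0_lt_compat; unfold r in *; lra.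
      - apply Rle_div_l; unfold r in *; lra. }
    assert (S2 : Cmod (/ f1 (z0 + w)%C) <= B).
    { apply Rle_trans with (1 := S'); unfold B; apply Rmult_le_compat_r; auto.
      apply Rmult_le_pos; [unfold r; lra|left; apply Rinv_0_lt_compat; lra]. }
    rewrite Cmod_inv in S2 by auto.
    rewrite Z in P2; replace (f1 (z0 + w) - 0)%C with (f1 (z0 + w)%C) in P2 by ring.
    apply Cmod_gt_0 in n.
    apply Rinv_lt_contravar in P2; [|apply Rmult_lt_0_compat; auto; now apply Rinv_0_lt_compat].
    rewrite Rinv_inv in P2. lra. }
  assert (E : f (z0 + RtoC (d' / 2))%C = f z0).
  { assert (M := mean_value_inequality f f1 z0 (z0 + RtoC (d' / 2))%C 0).
    assert (M' : Cmod (f (z0 + RtoC (d' / 2))%C - f z0) <= 0 * Cmod (z0 + RtoC (d' / 2) - z0)).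
    { apply M; intros s Hs.
      replace (s * (z0 + RtoC (d' / 2) - z0))%C with (RtoC (s * (d' / 2)))
        by (rewrite RtoC_mult; ring).
      assert (Hs' : Cmod (RtoC (s * (d' / 2))) < d').
      { rewrite Cmod_R, Rabs_pos_eq; nra. }
      split.
      - apply Hff, HD; unfold r in *; lra.
      - rewrite Flat by auto. rewrite Cmod_0; lra. }
    rewrite Rmult_0_l in M'.
    assert (M2 := Cmod_eq_0 _ (Rle_antisym _ _ M' (Cmod_ge_0 _))).
    replace (f (z0 + RtoC (d' / 2))%C) with (f (z0 + RtoC (d' / 2)) - f z0 + f z0)%C by ring.
    rewrite M2; ring. }
  apply Hi in E; auto.
  - assert (E2 : RtoC (d' / 2) = RtoC 0).
    { replace (RtoC (d' / 2)) with (z0 + RtoC (d' / 2) - z0)%C by ring. rewrite E; ring. }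
    apply RtoC_inj in E2; lra.
  - apply HD. rewrite Cmod_R, Rabs_pos_eq; unfold r in *; lra.
Qed.

(** * Convex functions: the bound on the second coefficient *)

Lemma in_disk_0 : in_disk 0.
Proof. unfold in_disk; rewrite Cmod_0; lra. Qed.

Lemma in_disk_opp z : in_disk z -> in_disk (- z)%C.
Proof. unfold in_disk; now rewrite Cmod_opp. Qed.

Lemma locally_in_disk z : in_disk z -> locally (T := C_UniformSpace) z in_disk.
Proof.
  intros Hz; destruct (in_disk_nbhd z Hz) as [d [Hd H]].
  apply locally_Cmod; exists d; split; auto; intros w Hw.
  replace w with (z + (w - z))%C by ring; auto.
Qed.

(** Openness of [F] makes its inverse continuous, hence every lift through [F] of
    a continuous function as well. *)
Lemma inverse_ccont (F g om : C -> C) (z0 : C) :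
  C1hol in_disk F -> injective_on_disk F ->
  (forall z, in_disk z -> in_disk (om z) /\ F (om z) = g z) ->
  ccont g z0 -> in_disk z0 -> ccont om z0.
Proof.
  intros HF Hi Hom Hg Hz0; apply ccont_eps; intros e He.
  destruct (open_mapping F (om z0) e HF Hi ltac:(now apply Hom) He) as [d [Hd H]].
  assert (Hl := proj1 (ccont_eps g z0) Hg d Hd).
  apply filter_imp with (2 := filter_and _ _ Hl (locally_in_disk z0 Hz0)).
  intros z [H1 H2].
  destruct (Hom z H2) as [O1 O2], (Hom z0 Hz0) as [O3 O4].
  destruct (H (g z)) as [w [W1 [W2 W3]]]; [now rewrite O4|].
  rewrite <- O2 in W3; apply Hi in W3; auto. now rewrite <- W3.
Qed.

(** Second-order Taylor expansion at 0 of a function with vanishing value and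
    derivative, by the mean value inequality for [om w - c w^2 / 2]. *)
Lemma tends_to_quadratic (om om' : C -> C) (c : C) :
  (forall z, in_disk z -> zderiv om z (om' z)) -> om 0 = RtoC 0 -> om' 0 = RtoC 0 ->
  zderiv om' (RtoC 0) c -> tends_to (fun z => om z / (z * z))%C 0 (c / 2)%C.
Proof.
  intros Hom H0 H1 Hc e He.
  assert (He2 : 0 < e / 2) by lra.
  destruct (tends_to_div_id om' c Hc H1 (e / 2) He2) as [d [Hd HP]].
  exists (Rmin d 1); split; [apply Rmin_glb_lt; lra|].
  intros z Hz Hzd; replace (z - 0)%C with z in Hzd by ring.
  assert (M := mean_value_inequality (fun w => om w - c / 2 * (w * w))%C
    (fun w => om' w - c * w)%C 0 z (e / 2 * Cmod z)).
  assert (M' : Cmod (om z - c / 2 * (z * z) - (om 0 - c / 2 * (0 * 0))) <=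
    e / 2 * Cmod z * Cmod (z - 0)).
  { apply M; intros s Hs.
    replace (0 + s * (z - 0))%C with (s * z)%C by ring.
    assert (Hsz : Cmod (s * z) <= Cmod z).
    { rewrite Cmod_mult, Cmod_R, Rabs_pos_eq by lra; generalize (Cmod_ge_0 z); nra. }
    assert (Hd1 := Rmin_l d 1). assert (Hd2 := Rmin_r d 1).
    split.
    - apply cderiv_minus; [apply Hom; unfold in_disk; lra|].
      apply cderiv_eq with (c / 2 * (1 * (s * z) + s * z * 1))%C; [|field].
      apply cderiv_scal, (cderiv_mult (fun w => w) (fun w => w) (fun w => w));
        [apply ccont_id|apply cderiv_iota|apply cderiv_iota].
    - destruct (Ceq_dec (s * z)%C 0) as [E|n].
      + rewrite E, H1; replace (0 - c * 0)%C with (RtoC 0) by ring; rewrite Cmod_0.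
        apply Rmult_le_pos; [lra|apply Cmod_ge_0].
      + replace (om' (s * z)%C - c * (s * z))%C
          with ((om' (s * z)%C / (s * z) - c) * (s * z))%C.
        2: { field. split; intros E; apply n; rewrite E; ring. }
        rewrite Cmod_mult; apply Rmult_le_compat; try apply Cmod_ge_0; auto.
        left; apply HP; auto. replace (s * z - 0)%C with (s * z)%C by ring; lra. }
  replace (om z / (z * z) - c / 2)%C
    with ((om z - c / 2 * (z * z) - (om 0 - c / 2 * (0 * 0))) / (z * z))%C
    by (rewrite H0; field; auto).
  assert (Hz' : (z * z)%C <> RtoC 0) by now apply Cmult_neq_0.
  rewrite Cmod_div by auto.
  apply Cmod_gt_0 in Hz'.
  apply Rle_lt_trans with (e / 2); [|lra].
  apply Rle_div_l; auto. rewrite Cmod_mult.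
  replace (z - 0)%C with z in M' by ring. lra.
Qed.

(** Midpoints of [F z] and [F (- z)] lie in the image, so they are [F (omega z)]
    for a self-map [omega] of the disk. It vanishes to second order at 0, and the
    maximum principle for [omega z / z^2] bounds its leading coefficient, which is
    half of the quotient F''(0) / F'(0). *)
Lemma convex_second_coefficient (F F1 F2 : C -> C) :
  (forall z, in_disk z -> zderiv F z (F1 z) /\ zderiv F1 z (F2 z)) ->
  (forall z, in_disk z -> F1 z <> RtoC 0) ->
  injective_on_disk F -> convex_set (image_of_disk F) ->
  Cmod (F2 0) <= 2 * Cmod (F1 0).
Proof.
  intros HD HN Hi Hconv.
  assert (K1 : forall z, in_disk z -> ccont F1 z).
  { intros z Hz; apply cderiv_ccont with (2 := proj2 (HD z Hz)), ccont_id. }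
  assert (HF : C1hol in_disk F).
  { exists F1; intros z Hz; split; [now apply HD|auto]. }
  set (g := fun z : C => ((F z + F (- z)) / 2)%C).
  assert (Ex : forall z, exists w, in_disk z -> in_disk w /\ F w = g z).
  { intros z; destruct (excluded_middle_informative (in_disk z)) as [Hz|Hz];
      [|exists z; tauto].
    destruct (Hconv (F z) (F (- z)%C) (/ 2)) as [w [W1 W2]].
    - now exists z.
    - exists (- z)%C; split; auto; now apply in_disk_opp.
    - lra.
    - exists w; intros _; split; auto; rewrite W2; unfold g.
      replace (1 - / 2) with (/ 2) by lra. rewrite RtoC_inv by lra. field. }
  set (om := fun z => proj1_sig (constructive_indefinite_description _ (Ex z))).
  assert (Hom : forall z, in_disk z -> in_disk (om z) /\ F (om z) = g z).
  { intros z; unfold om; destruct constructive_indefinite_description; auto. }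
  assert (Dneg : forall z, zderiv (fun z => - z)%C z (- (1))%C).
  { intros z; apply cderiv_opp, cderiv_iota. }
  set (g1 := fun z : C => ((F1 z - F1 (- z)) / 2)%C).
  assert (Dg : forall z, in_disk z -> zderiv g z (g1 z)).
  { intros z Hz; apply cderiv_ext with (fun z => / 2 * (F z + F (- z)))%C;
      [intros; unfold g; field|].
    apply cderiv_eq with (/ 2 * (F1 z + F1 (- z) * - (1)))%C; [|unfold g1; field].
    apply cderiv_scal, cderiv_plus; [now apply HD|].
    apply (cderiv_comp _ F (fun z => - z)%C); [apply ccont_id| |apply Dneg].
    now apply HD, in_disk_opp. }
  assert (Kom : forall z, in_disk z -> ccont om z).
  { intros z Hz; apply inverse_ccont with F g; auto.
    apply cderiv_ccont with (2 := Dg z Hz), ccont_id. }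
  set (om' := fun z => (g1 z / F1 (om z))%C).
  assert (Dom : forall z, in_disk z -> zderiv om z (om' z)).
  { intros z Hz; destruct (Hom z Hz) as [O1 O2].
    apply (cderiv_lift _ F); auto.
    - now apply HD.
    - apply cderiv_ext_loc with (2 := Dg z Hz).
      apply filter_imp with (2 := locally_in_disk z Hz).
      intros w Hw; symmetry; now apply Hom. }
  assert (D0 := in_disk_0).
  assert (Om0 : om 0 = RtoC 0).
  { destruct (Hom 0 D0) as [O1 O2]; apply Hi; auto.
    rewrite O2; unfold g; replace (- 0)%C with (RtoC 0) by ring; field. }
  assert (G10 : g1 0 = RtoC 0).
  { unfold g1; replace (- 0)%C with (RtoC 0) by ring; field. }
  assert (Om'0 : om' 0 = RtoC 0).
  { unfold om'; rewrite G10, Om0; field; auto. }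
  assert (Dom' : zderiv om' (RtoC 0) (F2 0 / F1 0)%C).
  { assert (Dg1 : zderiv g1 (RtoC 0) (F2 0)).
    { apply cderiv_ext with (fun z => / 2 * (F1 z - F1 (- z)))%C;
        [intros; unfold g1; field|].
      apply cderiv_eq with (/ 2 * (F2 0 - F2 (- 0) * - (1)))%C;
        [|replace (- 0)%C with (RtoC 0) by ring; field].
      apply cderiv_scal, cderiv_minus; [now apply HD|].
      apply (cderiv_comp _ F1 (fun z => - z)%C); [apply ccont_id| |apply Dneg].
      replace (- 0)%C with (RtoC 0) by ring; now apply HD. }
    assert (Dh : zderiv (fun z => F1 (om z)) (RtoC 0) (F2 0 * 0)%C).
    { apply (cderiv_comp _ F1 om); [apply ccont_id| |].
      - rewrite Om0; now apply HD.
      - now apply cderiv_eq with (om' 0); [apply Dom|]. }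
    apply cderiv_eq with ((F2 0 * F1 (om 0) - g1 0 * (F2 0 * 0)) / (F1 (om 0) * F1 (om 0)))%C.
    - apply (cderiv_div _ g1 (fun z => F1 (om z)));
        [apply ccont_id|rewrite Om0; auto|exact Dg1|exact Dh].
    - rewrite Om0, G10; field; auto. }
  assert (L := tends_to_quadratic om om' _ Dom Om0 Om'0 Dom').
  assert (Hk : C1hol (fun w => Cmod w < 1 /\ w <> RtoC 0) (fun z => om z / (z * z))%C).
  { apply C1hol_div.
    - exists om'; intros z [Hz _]; split; auto.
      destruct (Hom z Hz) as [O1 O2].
      apply ccont_div; auto.
      + apply ccont_div; [|apply ccont_const|].
        * apply ccont_minus; auto.
          apply (continuous_comp (fun z => - z)%C F1).
          -- apply ccont_opp, ccont_id.
          -- now apply K1, in_disk_opp.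
        * intros E; apply RtoC_inj in E; lra.
      + apply (continuous_comp om F1); auto.
    - apply C1hol_mult; apply C1hol_id.
    - intros z [_ Hz]; now apply Cmult_neq_0. }
  set (A := Cmod (F2 0 / F1 0 / 2)).
  assert (B : forall r, 0 < r < 1 -> A * r ^ 2 <= 1).
  { intros r Hr.
    assert (S := sup_bound _ 0 _ r 1 (/ r ^ 2) ltac:(rewrite Cmod_0; lra) ltac:(lra) Hk L).
    fold A in S; rewrite Cmod_0 in S.
    replace (((r + 0) / (r - 0)) ^ 2 * / r ^ 2) with (/ r ^ 2) in S by (field; lra).
    assert (Hr2 : 0 < r ^ 2) by (apply pow_lt; lra).
    apply Rle_div_r; auto. unfold Rdiv; rewrite Rmult_1_l; apply S; intros t _.
    assert (Hc := Cmod_circle r t ltac:(lra)).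
    assert (Hc0 := circle_neq_0 r t ltac:(lra)).
    rewrite Cmod_div by now apply Cmult_neq_0.
    rewrite Cmod_mult, Hc.
    replace (/ r ^ 2) with (1 / (r * r)) by (field; lra).
    apply Rmult_le_compat_r; [left; apply Rinv_0_lt_compat; nra|].
    left; apply Hom; unfold in_disk; lra. }
  assert (A1 : A <= 1).
  { destruct (Rle_dec A 1) as [|n]; auto; exfalso.
    assert (HA : 1 < A) by lra.
    (* With this x, A (1 - x)^2 >= A - 2 A x = (A + 1) / 2 > 1. *)
    set (x := (A - 1) / (4 * A)).
    assert (Hx : 0 < x < 1).
    { unfold x; split; [apply Rdiv_lt_0_compat; lra|].
      apply Rlt_div_l; lra. }
    assert (B' := B (1 - x) ltac:(lra)).
    assert (Ex' : A * x = (A - 1) / 4) by (unfold x; field; lra).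
    nra. }
  unfold A in A1. assert (N0 := HN 0 D0).
  assert (two : RtoC 2 <> RtoC 0) by (intros E; apply RtoC_inj in E; lra).
  rewrite !Cmod_div, Cmod_R, Rabs_pos_eq in A1 by (auto; lra).
  apply Cmod_gt_0 in N0.
  replace (Cmod (F2 0)) with (Cmod (F2 0) / Cmod (F1 0) / 2 * (2 * Cmod (F1 0)))
    by (field; lra).
  nra.
Qed.

(** * Complex power series *)

(** The form in which a termwise estimate of a power series yields the
    derivative. *)
Lemma zderiv_quadratic (g : C -> C) (z e : C) (K d : R) :
  0 < d ->
  (forall w, Cmod (w - z) < d -> Cmod (g w - g z - e * (w - z)) <= K * Cmod (w - z) ^ 2) ->
  zderiv g z e.
Proof.
  intros Hd H.
  set (q := fun w => if Ceq_dec w z then e else ((g w - g z) / (w - z))%C).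
  assert (qz : q z = e) by (unfold q; destruct (Ceq_dec z z); tauto).
  assert (E0 : forall w : C, w <> z -> (w - z)%C <> RtoC 0).
  { intros w Hw E; apply Hw; replace w with (w - z + z)%C by ring; rewrite E; ring. }
  exists q; split; [|split; auto].
  - apply ccont_eps; intros eps He; apply locally_Cmod.
    assert (HK : 0 < Rabs K + 1) by (generalize (Rabs_pos K); lra).
    exists (Rmin d (eps / (Rabs K + 1))); split.
    { apply Rmin_glb_lt; auto; now apply Rdiv_lt_0_compat. }
    intros w Hw.
    assert (H1 := Rlt_le_trans _ _ _ Hw (Rmin_l _ _)).
    assert (H2 := Rlt_le_trans _ _ _ Hw (Rmin_r _ _)).
    rewrite qz; unfold q; destruct (Ceq_dec w z) as [E|n].
    + replace (e - e)%C with (RtoC 0) by ring; now rewrite Cmod_0.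
    + apply E0 in n.
      replace ((g w - g z) / (w - z) - e)%C
        with ((g w - g z - e * (w - z)) / (w - z))%C by (field; auto).
      rewrite Cmod_div by auto. apply Cmod_gt_0 in n.
      apply Rle_lt_trans with (K * Cmod (w - z)).
      * apply Rle_div_l; auto. generalize (H w H1); lra.
      * apply Rlt_div_r in H2; auto.
        generalize (Rle_abs K); intros.
        apply Rle_lt_trans with (2 := H2). nra.
  - apply filter_forall; intros w; unfold q.
    match goal with |- context [Ceq_dec ?a ?b] => destruct (Ceq_dec a b) as [E|n] end.
    + change (w = z) in E; subst w; ring.
    + apply E0 in n; field; auto.
Qed.

Definition ex_csum (u : nat -> C) :=
  ex_series (fun n => Re (u n)) /\ ex_series (fun n => Im (u n)).
(** Summing real and imaginary parts separately gives a total sum operator and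
    reduces all algebra of sums to real series. *)
Definition csum (u : nat -> C) : C :=
  (Series (fun n => Re (u n)), Series (fun n => Im (u n))).

Lemma csum_incr u : ex_csum u -> u 0%nat = RtoC 0 -> csum u = csum (fun n => u (S n)).
Proof.
  intros [H1 H2] E; unfold csum.
  rewrite (Series_incr_1 (fun n => Re (u n))), (Series_incr_1 (fun n => Im (u n))) by auto.
  rewrite E; f_equal; unfold Re, Im; simpl; ring.
Qed.

Lemma ex_csum_incr u : ex_csum u <-> ex_csum (fun n => u (S n)).
Proof.
  unfold ex_csum.
  now rewrite (ex_series_incr_1 (fun n => Re (u n))), (ex_series_incr_1 (fun n => Im (u n))).
Qed.

Lemma ex_csum_minus u v : ex_csum u -> ex_csum v -> ex_csum (fun n => u n - v n)%C.
Proof. intros [] []; split; now apply (ex_series_minus (V := R_NormedModule)). Qed.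

Lemma csum_minus u v :
  ex_csum u -> ex_csum v -> csum (fun n => u n - v n)%C = (csum u - csum v)%C.
Proof.
  intros [H1 H2] [H3 H4].
  assert (E1 := Series_minus _ _ H1 H3). assert (E2 := Series_minus _ _ H2 H4).
  unfold csum, Cminus, Cplus, Copp; simpl. f_equal; auto.
Qed.

Lemma ex_csum_scal (c : C) u : ex_csum u -> ex_csum (fun n => c * u n)%C.
Proof.
  intros [H1 H2]; split.
  - apply ex_series_ext with (fun n => Re c * Re (u n) - Im c * Im (u n)); [now intros; rewrite re_mult|].
    apply (ex_series_minus (V := R_NormedModule));
      now apply (ex_series_scal_l (K := R_AbsRing) (V := R_NormedModule)).
  - apply ex_series_ext with (fun n => Re c * Im (u n) + Im c * Re (u n)); [now intros; rewrite im_mult|].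
    apply (ex_series_plus (V := R_NormedModule));
      now apply (ex_series_scal_l (K := R_AbsRing) (V := R_NormedModule)).
Qed.

Lemma csum_scal (c : C) u : ex_csum u -> csum (fun n => c * u n)%C = (c * csum u)%C.
Proof.
  intros [H1 H2].
  assert (S : forall (k : R) (v : nat -> R), ex_series v -> ex_series (fun n => k * v n))
    by (intros k v; exact (ex_series_scal_l (K := R_AbsRing) (V := R_NormedModule) k v)).
  assert (E1 : Series (fun n => Re (c * u n)%C) =
    Re c * Series (fun n => Re (u n)) - Im c * Series (fun n => Im (u n))).
  { rewrite <- !Series_scal_l, <- Series_minus by auto.
    apply Series_ext; intros; apply re_mult. }
  assert (E2 : Series (fun n => Im (c * u n)%C) =
    Re c * Series (fun n => Im (u n)) + Im c * Series (fun n => Re (u n))).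
  { rewrite <- !Series_scal_l, <- Series_plus by auto.
    apply Series_ext; intros; apply im_mult. }
  unfold csum; rewrite E1, E2; unfold Cmult, Re, Im; simpl; f_equal; ring.
Qed.

Lemma im_le_Cmod (c : C) : Rabs (Im c) <= Cmod c.
Proof. apply Rle_trans with (2 := Rmax_Cmod c), Rmax_r. Qed.

Lemma ex_csum_le u (B : nat -> R) :
  (forall n, Cmod (u n) <= B n) -> ex_series B -> ex_csum u.
Proof.
  intros H HB; split; apply (ex_series_le (V := R_CompleteNormedModule)) with (2 := HB);
    intros n; apply Rle_trans with (2 := H n); [apply re_le_Cmod|apply im_le_Cmod].
Qed.

(** The factor 2, from estimating real and imaginary parts separately, is
    harmless in the only use, a bound of order |w - z|^2. *)
Lemma Cmod_csum_le u (B : nat -> R) :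
  (forall n, Cmod (u n) <= B n) -> ex_series B -> Cmod (csum u) <= 2 * Series B.
Proof.
  intros H HB.
  assert (K : forall v : nat -> R, (forall n, Rabs (v n) <= B n) -> Rabs (Series v) <= Series B).
  { intros v Hv.
    assert (Hs : ex_series (fun n => Rabs (v n))).
    { apply (ex_series_le (V := R_CompleteNormedModule)) with (2 := HB).
      intros n; unfold norm; simpl; unfold abs; simpl; now rewrite Rabs_Rabsolu. }
    apply Rle_trans with (1 := Series_Rabs _ Hs), Series_le; auto.
    intros n; split; auto using Rabs_pos. }
  assert (K1 := K (fun n => Re (u n)) (fun n => Rle_trans _ _ _ (re_le_Cmod _) (H n))).
  assert (K2 := K (fun n => Im (u n)) (fun n => Rle_trans _ _ _ (im_le_Cmod _) (H n))).
  replace (csum u) with (RtoC (Re (csum u)) + Ci * RtoC (Im (csum u)))%C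
    by (unfold Cplus, Cmult; simpl; unfold csum; f_equal; simpl; ring).
  apply Rle_trans with (1 := Cmod_triangle _ _).
  rewrite Cmod_mult, Cmod_Ci, !Cmod_R; simpl; lra.
Qed.

Definition power_sum (b : nat -> C) (z : C) : C := csum (fun n => b n * z ^ n)%C.
Definition pderive (b : nat -> C) (n : nat) : C := (INR (S n) * b (S n))%C.
(** Absolute convergence on the disk, expressed by the real power series of the
    moduli, whose radius of convergence is known to be stable under
    differentiation. *)
Definition disk_summable (b : nat -> C) := Rbar_le 1 (CV_radius (fun n => Cmod (b n))).

Lemma Cmod_pderive b n : Cmod (pderive b n) = PS_derive (fun n => Cmod (b n)) n.
Proof.
  unfold pderive, PS_derive; rewrite Cmod_mult, Cmod_R, Rabs_pos_eq; auto using pos_INR.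
Qed.

Lemma disk_summable_pderive b : disk_summable b -> disk_summable (pderive b).
Proof.
  unfold disk_summable; intros H.
  rewrite (CV_radius_ext _ _ (Cmod_pderive b)), CV_radius_derive; auto.
Qed.

Lemma disk_summable_ex_series b r : disk_summable b -> 0 <= r < 1 ->
  ex_series (fun n => Cmod (b n) * r ^ n).
Proof.
  intros H Hr.
  assert (H1 : Rbar_lt (Rabs r) (CV_radius (fun n => Cmod (b n)))).
  { apply Rbar_lt_le_trans with (Finite 1); [simpl; rewrite Rabs_pos_eq; lra|exact H]. }
  apply ex_series_ext with (2 := CV_disk_inside _ _ H1); intros n.
  apply Rabs_pos_eq, Rmult_le_pos; [apply Cmod_ge_0|apply pow_le; lra].
Qed.

Lemma Cmod_pow_le z r n : Cmod z <= r -> Cmod (z ^ n) <= r ^ n.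
Proof.
  intros H; rewrite Cmod_pow; apply pow_incr; split; auto using Cmod_ge_0.
Qed.

Lemma ex_csum_power_sum b z : disk_summable b -> in_disk z -> ex_csum (fun n => b n * z ^ n)%C.
Proof.
  intros H Hz; apply ex_csum_le with (fun n => Cmod (b n) * Cmod z ^ n).
  - intros n; rewrite Cmod_mult; apply Rmult_le_compat_l; auto using Cmod_ge_0.
    apply Cmod_pow_le; lra.
  - apply disk_summable_ex_series; auto; split; auto using Cmod_ge_0.
Qed.

Lemma pow_remainder_le (z w : C) (r : R) (k : nat) :
  Cmod z <= r -> Cmod w <= r ->
  Cmod (w ^ S (S k) - z ^ S (S k) - INR (S (S k)) * (w - z) * z ^ S k)
  <= Cmod (w - z) ^ 2 * (INR (S (S k)) * INR (S k) * r ^ k).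
Proof.
  intros Hz Hw; assert (Hr : 0 <= r) by (apply Rle_trans with (2 := Hz), Cmod_ge_0).
  induction k as [|k IH].
  - replace (w ^ 2 - z ^ 2 - INR 2 * (w - z) * z ^ 1)%C with ((w - z) ^ 2)%C.
    + rewrite Cmod_pow; simpl; generalize (pow2_ge_0 (Cmod (w - z))); simpl; lra.
    + replace (INR 2) with 2 by (simpl; ring). ring.
  - set (T := (w ^ S (S k) - z ^ S (S k) - INR (S (S k)) * (w - z) * z ^ S k)%C) in *.
    replace (w ^ S (S (S k)) - z ^ S (S (S k)) - INR (S (S (S k))) * (w - z) * z ^ S (S k))%C
      with (w * T + INR (S (S k)) * (w - z) ^ 2 * z ^ S k)%C.
    2: { unfold T; rewrite (S_INR (S (S k))), RtoC_plus; simpl Cpow; ring. }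
    apply Rle_trans with (1 := Cmod_triangle _ _).
    rewrite !Cmod_mult, !Cmod_R, Rabs_pos_eq, (Cmod_pow (w - z)) by apply pos_INR.
    assert (H1 : Cmod w * Cmod T <= r * (Cmod (w - z) ^ 2 * (INR (S (S k)) * INR (S k) * r ^ k))).
    { apply Rmult_le_compat; auto using Cmod_ge_0. }
    assert (H2 : INR (S (S k)) * Cmod (w - z) ^ 2 * Cmod (z ^ S k)
      <= INR (S (S k)) * Cmod (w - z) ^ 2 * r ^ S k).
    { apply Rmult_le_compat_l; [apply Rmult_le_pos; [apply pos_INR|apply pow2_ge_0]|].
      now apply Cmod_pow_le. }
    apply Rle_trans with (1 := Rplus_le_compat _ _ _ _ H1 H2).
    replace (r ^ S k) with (r * r ^ k) by (simpl; ring).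
    rewrite !(S_INR k), (S_INR (S (S k))), !(S_INR (S k)), !(S_INR k).
    assert (P1 := pos_INR k). assert (P2 := pow_le r k Hr). assert (P3 := pow2_ge_0 (Cmod (w - z))).
    set (X := Cmod (w - z) ^ 2) in *. set (Y := r ^ k) in *. set (n := INR k) in *.
    replace (r * (X * ((n + 1 + 1) * (n + 1) * Y)) + (n + 1 + 1) * X * (r * Y))
      with (X * (r * Y) * ((n + 2) * (n + 2))) by ring.
    replace (X * ((n + 1 + 1 + 1) * (n + 1 + 1) * (r * Y)))
      with (X * (r * Y) * ((n + 2) * (n + 3))) by ring.
    apply Rmult_le_compat_l; [|nra].
    apply Rmult_le_pos; auto. now apply Rmult_le_pos.
Qed.

(** Termwise, the second-order remainders are at most |w - z|^2 times the
    terms of the second derivative of the series of moduli, at a radius between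
    |z| and 1. *)
Lemma zderiv_power_sum (b : nat -> C) (z : C) :
  disk_summable b -> in_disk z -> zderiv (power_sum b) z (power_sum (pderive b) z).
Proof.
  intros Hb Hz; unfold in_disk in Hz.
  set (r := (1 + Cmod z) / 2).
  assert (Hz0 := Cmod_ge_0 z).
  assert (Hr : 0 <= r < 1) by (unfold r; lra).
  assert (Hb1 := disk_summable_pderive b Hb).
  assert (Hb2 := disk_summable_pderive _ Hb1).
  set (M := fun k => Cmod (pderive (pderive b) k) * r ^ k).
  assert (HM : ex_series M) by now apply disk_summable_ex_series.
  apply zderiv_quadratic with (2 * Series M) (r - Cmod z); [unfold r; lra|].
  intros w Hw.
  assert (Hwr : Cmod w <= r).
  { replace w with (w - z + z)%C by ring.
    apply Rle_trans with (1 := Cmod_triangle _ _); lra. }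
  assert (Hzr : Cmod z <= r) by (unfold r; lra).
  (* The derived series shifted back by one index, so that it aligns with the difference of the two power series. *)
  set (v := fun n => match n with O => RtoC 0 | S k => (pderive b k * z ^ k)%C end).
  assert (Ew : ex_csum (fun n => b n * w ^ n)%C) by (apply ex_csum_power_sum; unfold in_disk; auto; lra).
  assert (Ez : ex_csum (fun n => b n * z ^ n)%C) by (apply ex_csum_power_sum; auto).
  assert (Ev : ex_csum v) by (apply ex_csum_incr, ex_csum_power_sum; auto).
  assert (Vv : power_sum (pderive b) z = csum v) by (rewrite (csum_incr v); auto).
  set (u := fun n => (b n * w ^ n - b n * z ^ n - (w - z) * v n)%C).
  assert (E1 := ex_csum_minus _ _ Ew Ez).
  assert (E2 := ex_csum_scal (w - z)%C _ Ev).
  assert (Eu : ex_csum u) by (apply ex_csum_minus; auto).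
  assert (Vu : csum u = (power_sum b w - power_sum b z - power_sum (pderive b) z * (w - z))%C).
  { unfold u; rewrite csum_minus, csum_minus, csum_scal, Vv; auto. unfold power_sum; ring. }
  rewrite <- Vu, (csum_incr u), (csum_incr (fun n => u (S n))); auto.
  2: { apply (ex_csum_incr u); auto. }
  2: { unfold u, v, pderive; simpl; ring. }
  2: { unfold u, v; simpl; ring. }
  apply Rle_trans with (2 * Series (fun k => Cmod (w - z) ^ 2 * M k)).
  - apply Cmod_csum_le.
    2: { now apply (ex_series_scal_l (K := R_AbsRing) (V := R_NormedModule)). }
    intros k.
    replace (u (S (S k))) with (b (S (S k)) *
      (w ^ S (S k) - z ^ S (S k) - INR (S (S k)) * (w - z) * z ^ S k))%C
      by (unfold u, v, pderive; ring).
    rewrite Cmod_mult; unfold M.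
    replace (Cmod (pderive (pderive b) k))
      with (INR (S k) * (INR (S (S k)) * Cmod (b (S (S k)))))
      by (rewrite Cmod_pderive; unfold PS_derive; now rewrite Cmod_pderive).
    apply Rle_trans with (1 := Rmult_le_compat_l _ _ _ (Cmod_ge_0 _) (pow_remainder_le z w r k Hzr Hwr)).
    right; ring.
  - rewrite Series_scal_l; right; ring.
Qed.

Lemma is_series_C_components (u : nat -> C) (l : C) :
  is_series (K := C_AbsRing) (V := C_NormedModule) u l ->
  is_series (fun n => Re (u n)) (Re l) /\ is_series (fun n => Im (u n)) (Im l).
Proof.
  intros H.
  assert (E : forall n, sum_n u n = (sum_n (fun k => Re (u k)) n, sum_n (fun k => Im (u k)) n) :> C).
  { induction n as [|n IH]; [rewrite !sum_O; now destruct (u 0%nat)|].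
    rewrite !sum_Sn, IH; now destruct (u (S n)). }
  assert (Cid : ccont (fun w : C => w) l) by apply continuous_id.
  apply ccont_iff in Cid; destruct Cid as [C1 C2].
  split; unfold is_series.
  - apply filterlim_ext with (fun n => Re (sum_n u n)); [intros n; now rewrite E|].
    apply filterlim_comp with (1 := H) (2 := C1).
  - apply filterlim_ext with (fun n => Im (sum_n u n)); [intros n; now rewrite E|].
    apply filterlim_comp with (1 := H) (2 := C2).
Qed.

Lemma pow_n_Cpow (z : C) (n : nat) : pow_n (K := C_Ring) z n = (z ^ n)%C.
Proof. induction n as [|n IH]; simpl; [reflexivity|now rewrite IH]. Qed.

Lemma is_pseries_components a z l :
  is_pseries (K := C_AbsRing) (V := C_NormedModule) a z l ->
  ex_csum (fun n => a n * z ^ n)%C /\ power_sum a z = l.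
Proof.
  intros H; apply is_series_C_components in H; destruct H as [H1 H2].
  assert (E : forall n, scal (pow_n (K := C_AbsRing) z n) (a n) = (a n * z ^ n)%C :> C).
  { intros n; rewrite <- pow_n_Cpow; unfold scal; simpl; apply Cmult_comm. }
  assert (H1' : is_series (fun n => Re (a n * z ^ n)%C) (Re l)).
  { apply is_series_ext with (2 := H1); intros; f_equal; apply E. }
  assert (H2' : is_series (fun n => Im (a n * z ^ n)%C) (Im l)).
  { apply is_series_ext with (2 := H2); intros; f_equal; apply E. }
  split; [split; eexists; eauto|].
  unfold power_sum, csum; rewrite (is_series_unique _ _ H1'), (is_series_unique _ _ H2').
  now destruct l.
Qed.

Lemma ex_series_bounded (u : nat -> R) : ex_series u -> exists M, forall n, Rabs (u n) <= M.
Proof.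
  intros H; apply ex_series_lim_0 in H.
  destruct (filterlim_bounded (V := R_NormedModule) u) as [M HM].
  { exists 0; exact H. }
  now exists M.
Qed.

Lemma expansion_disk_summable (f : C -> C) a :
  normalized_expansion f a -> disk_summable a.
Proof.
  intros [_ [_ H]].
  assert (B : forall r, 0 <= r < 1 -> Rbar_le r (CV_radius (fun n => Cmod (a n)))).
  { intros r Hr; apply (CV_radius_bounded (fun n => Cmod (a n))).
    assert (Hd : in_disk r) by (unfold in_disk; rewrite Cmod_R, Rabs_pos_eq; lra).
    destruct (proj1 (is_pseries_components _ _ _ (H r Hd))) as [E1 E2].
    destruct (ex_series_bounded _ E1) as [M1 B1], (ex_series_bounded _ E2) as [M2 B2].
    exists (M1 + M2); intros n.
    replace (Rabs (Cmod (a n) * r ^ n)) with (Cmod (a n * r ^ n)).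
    - set (c := (a n * r ^ n)%C).
      replace c with (RtoC (Re c) + Ci * RtoC (Im c))%C
        by (destruct c as [x y]; unfold Cplus, Cmult; simpl; f_equal; ring).
      apply Rle_trans with (1 := Cmod_triangle _ _).
      rewrite Cmod_mult, Cmod_Ci, !Cmod_R, Rmult_1_l.
      apply Rplus_le_compat; [exact (B1 n)|exact (B2 n)].
    - rewrite Cmod_mult, Cmod_pow, Cmod_R, Rabs_mult, RPow_abs.
      rewrite (Rabs_pos_eq (Cmod (a n))); auto using Cmod_ge_0. }
  unfold disk_summable; destruct (CV_radius (fun n => Cmod (a n))) as [c| |]; simpl in *; auto.
  - destruct (Rle_dec 1 c) as [|n]; auto; exfalso.
    assert (B0 := B 0 ltac:(lra)).
    assert (B1 := B ((1 + c) / 2) ltac:(lra)). lra.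
  - apply (B 0); lra.
Qed.

(** * The exponential, the logarithm and the sector functions *)

(** Complex-linear directional derivatives that depend continuously on the point
    give a complex derivative. This plays the role of the Cauchy-Riemann
    criterion for functions given by real formulas. *)
Lemma zderiv_of_directional (g g' : C -> C) (z : C) :
  (forall a b (s : R), rderiv (fun s : R => g (a + s * b)%C) s (g' (a + s * b) * b)%C) ->
  ccont g' z -> zderiv g z (g' z).
Proof.
  intros Hd Hc; apply zderiv_is_derive.
  split; [apply is_linear_scal_l|].
  intros x Hx.
  assert (Ex : z = x)
    by exact (is_filter_lim_locally_unique (V := AbsRing_NormedModule C_AbsRing) z x Hx).
  subst x; intros e; apply (proj1 (locally_C z _)).
  destruct (proj1 (locally_Cmod z _) (proj1 (ccont_eps g' z) Hc e (cond_pos e))) as [d [Hd' H]].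
  apply locally_Cmod; exists d; split; auto; intros w Hw.
  change (Cmod (g w - g z - (w - z) * g' z) <= e * Cmod (w - z)).
  assert (P := path_increment_le (fun s => g (z + s * (w - z)) - s * ((w - z) * g' z))%C
    (fun s => g' (z + s * (w - z)) * (w - z) - (w - z) * g' z)%C (e * Cmod (w - z))).
  cbv beta in P.
  replace (z + 1 * (w - z))%C with w in P by ring.
  replace (z + 0 * (w - z))%C with z in P by ring.
  replace (g w - g z - (w - z) * g' z)%C
    with (g w - 1 * ((w - z) * g' z) - (g z - 0 * ((w - z) * g' z)))%C by ring.
  apply P; intros s Hs; split.
  - apply cderiv_minus; [apply Hd|].
    apply cderiv_ext with (fun s : R => ((w - z) * g' z) * s)%C; [intros; ring|].
    apply cderiv_eq with (((w - z) * g' z) * 1)%C; [|ring].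
    apply cderiv_scal, cderiv_iota.
  - replace (g' (z + s * (w - z)) * (w - z) - (w - z) * g' z)%C
      with ((g' (z + s * (w - z)) - g' z) * (w - z))%C by ring.
    rewrite Cmod_mult; apply Rmult_le_compat_r; [apply Cmod_ge_0|].
    left; apply H.
    replace (z + s * (w - z) - z)%C with (s * (w - z))%C by ring.
    rewrite Cmod_mult, Cmod_R, Rabs_pos_eq by lra.
    apply Rle_lt_trans with (2 := Hw). generalize (Cmod_ge_0 (w - z)); nra.
Qed.

Lemma ccont_Cexp z : ccont Cexp z.
Proof.
  assert (H := ccont_id z); apply ccont_iff in H; destruct H as [H1 H2].
  apply ccont_iff; split; apply continuous_Rmult.
  - apply (continuous_comp _ exp); auto using continuous_exp.
  - apply (continuous_comp _ cos); auto using continuous_cos.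
  - apply (continuous_comp _ exp); auto using continuous_exp.
  - apply (continuous_comp _ sin); auto using continuous_sin.
Qed.

Lemma zderiv_Cexp z : zderiv Cexp z (Cexp z).
Proof.
  apply zderiv_of_directional; [|apply ccont_Cexp].
  intros [a1 a2] [b1 b2] s.
  set (u := fun s => exp (a1 + s * b1) * cos (a2 + s * b2)).
  set (v := fun s => exp (a1 + s * b1) * sin (a2 + s * b2)).
  apply cderiv_ext with (fun s => (u s, v s) : C).
  { intros t; unfold Cexp, u, v; simpl; do 2 f_equal; f_equal; ring. }
  apply cderiv_eq with ((u s * b1 - v s * b2, u s * b2 + v s * b1) : C).
  - unfold u, v; apply is_derive_rderiv; auto_derive; auto; ring.
  - unfold Cexp, Cmult, u, v; simpl.
    replace (a1 + (s * b1 - 0 * b2)) with (a1 + s * b1) by ring.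
    replace (a2 + (s * b2 + 0 * b1)) with (a2 + s * b2) by ring.
    reflexivity.
Qed.

Lemma Cexp_neq_0 z : Cexp z <> RtoC 0.
Proof.
  intros E; injection E; intros E1 E2.
  assert (P := exp_pos (Re z)).
  assert (H := sin2_cos2 (Im z)); unfold Rsqr in H.
  apply Rmult_integral in E1; apply Rmult_integral in E2.
  destruct E1 as [E1|E1], E2 as [E2|E2]; try lra. rewrite E1, E2 in H; lra.
Qed.

Lemma Cexp_0 : Cexp 0 = RtoC 1.
Proof. unfold Cexp; simpl; rewrite exp_0, cos_0, sin_0; unfold RtoC; f_equal; ring. Qed.

Lemma Cmod_atan (w : C) : 0 < Re w ->
  Cmod w = Re w * sqrt (1 + (Im w / Re w) ^ 2).
Proof.
  intros Hw.
  rewrite <- (sqrt_pow2 (Re w)) at 1 by lra.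
  rewrite <- sqrt_mult.
  - unfold Cmod; f_equal; fold (Re w) (Im w); field; lra.
  - apply pow2_ge_0.
  - generalize (pow2_ge_0 (Im w / Re w)); lra.
Qed.

(** In the right half-plane the two-branch formula with [acos] is a single smooth
    expression; continuity of the logarithm is read off from it. *)
Lemma Carg_atan (w : C) : 0 < Re w -> Carg w = atan (Im w / Re w).
Proof.
  intros Hw.
  assert (Hm := Cmod_atan w Hw).
  assert (S0 : 0 < sqrt (1 + (Im w / Re w) ^ 2)).
  { apply sqrt_lt_R0; generalize (pow2_ge_0 (Im w / Re w)); lra. }
  assert (E : Re w / Cmod w = cos (atan (Im w / Re w))).
  { rewrite cos_atan, Hm; unfold Rsqr.
    replace (Im w / Re w * (Im w / Re w)) with ((Im w / Re w) ^ 2) by ring.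
    field; lra. }
  destruct (atan_bound (Im w / Re w)) as [B1 B2].
  unfold Carg; rewrite E; destruct (Rle_dec 0 (Im w)) as [H|H].
  - apply acos_cos; split; [|lra].
    destruct H as [H|H].
    + left; rewrite <- atan_0; apply atan_increasing, Rdiv_lt_0_compat; auto.
    + rewrite <- H; replace (0 / Re w) with 0 by (field; lra); rewrite atan_0; lra.
  - rewrite <- cos_neg, acos_cos; [ring|]; split; [|lra].
    assert (atan (Im w / Re w) < 0); [|lra].
    rewrite <- atan_0; apply atan_increasing.
    apply Rlt_div_l; lra.
Qed.

Lemma Cexp_Clog (w : C) : 0 < Re w -> Cexp (Clog w) = w.
Proof.
  intros Hw; assert (Hm := Cmod_atan w Hw).
  assert (S0 : 0 < sqrt (1 + (Im w / Re w) ^ 2)).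
  { apply sqrt_lt_R0; generalize (pow2_ge_0 (Im w / Re w)); lra. }
  unfold Cexp, Clog; simpl; rewrite Carg_atan, exp_ln by (auto; rewrite Hm; now apply Rmult_lt_0_compat).
  rewrite cos_atan, sin_atan; unfold Rsqr.
  replace (Im w / Re w * (Im w / Re w)) with ((Im w / Re w) ^ 2) by ring.
  rewrite Hm; destruct w as [x y]; simpl in *; f_equal; field; lra.
Qed.

Lemma locally_Re_pos (w : C) : 0 < Re w -> locally (T := C_UniformSpace) w (fun v => 0 < Re v).
Proof.
  intros Hw; apply continuous_pos_locally; auto.
  apply continuous_Re_R, ccont_id.
Qed.

Lemma ccont_Clog (w : C) : 0 < Re w -> ccont Clog w.
Proof.
  intros Hw.
  assert (H := ccont_id w); apply ccont_iff in H; destruct H as [H1 H2].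
  apply ccont_iff; split.
  - apply (continuous_comp _ ln).
    + apply continuous_Cmod, ccont_id.
    + apply continuous_ln. rewrite Cmod_atan; auto.
      apply Rmult_lt_0_compat; auto.
      apply sqrt_lt_R0; generalize (pow2_ge_0 (Im w / Re w)); lra.
  - apply (continuous_ext_loc _ (fun v : C_UniformSpace => atan (Im v / Re v))).
    + apply filter_imp with (2 := locally_Re_pos w Hw); intros v Hv.
      symmetry; now apply Carg_atan.
    + apply (continuous_comp _ atan); [|apply continuous_atan].
      apply continuous_Rmult; auto. apply continuous_Rinv_gen; auto; lra.
Qed.

Lemma zderiv_Clog (w : C) : 0 < Re w -> zderiv Clog w (/ w)%C.
Proof.
  intros Hw.
  apply cderiv_eq with (1 / Cexp (Clog w))%C.
  - apply (cderiv_lift _ Cexp); [now apply ccont_Clog|apply zderiv_Cexp|apply Cexp_neq_0|].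
    apply cderiv_ext_loc with (fun v : C => v); [|apply cderiv_iota].
    apply filter_imp with (2 := locally_Re_pos w Hw); intros v Hv.
    symmetry; now apply Cexp_Clog.
  - rewrite Cexp_Clog by auto.
    field. intros E; rewrite E in Hw; simpl in Hw; lra.
Qed.

Lemma one_minus_neq_0 z : in_disk z -> (1 - z)%C <> RtoC 0.
Proof.
  intros Hz E; unfold in_disk in Hz.
  replace z with (1 - (1 - z))%C in Hz by ring.
  rewrite E in Hz; replace (1 - 0)%C with (RtoC 1) in Hz by ring.
  rewrite Cmod_1 in Hz; lra.
Qed.

Lemma one_plus_neq_0 z : in_disk z -> (1 + z)%C <> RtoC 0.
Proof.
  intros Hz; replace (1 + z)%C with (1 - - z)%C by ring.
  now apply one_minus_neq_0, in_disk_opp.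
Qed.

Lemma one_minus_sqr_neq_0 z : in_disk z -> (1 - z * z)%C <> RtoC 0.
Proof.
  intros Hz; replace (1 - z * z)%C with ((1 - z) * (1 + z))%C by ring.
  apply Cmult_neq_0; auto using one_minus_neq_0, one_plus_neq_0.
Qed.

Lemma cayley_Re_pos z : in_disk z -> 0 < Re ((1 + z) / (1 - z))%C.
Proof.
  intros Hz; assert (Hn := one_minus_neq_0 z Hz); unfold in_disk in Hz.
  assert (H1 := Cmod2_alt z); assert (H0 := Cmod_ge_0 z).
  apply Cmod_gt_0 in Hn; assert (H2 := Cmod2_alt (1 - z)).
  assert (H3 : 0 < Cmod (1 - z) ^ 2) by (apply pow_lt; auto).
  destruct z as [x y]; unfold Re, Im in *; simpl in *.
  replace ((1 + x) * ((1 + - x) / ((1 + - x) * ((1 + - x) * 1) + (0 + - y) * ((0 + - y) * 1))) -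
    (0 + y) * (- (0 + - y) / ((1 + - x) * ((1 + - x) * 1) + (0 + - y) * ((0 + - y) * 1))))
    with ((1 - (x * (x * 1) + y * (y * 1))) /
      ((1 + - x) * ((1 + - x) * 1) + (0 + - y) * ((0 + - y) * 1)))
    by (field; intros E; nra).
  apply Rdiv_lt_0_compat; nra.
Qed.

Definition log_cayley (z : C) : C := Clog ((1 + z) / (1 - z)).

Lemma zderiv_log_cayley z : in_disk z -> zderiv log_cayley z (2 / (1 - z * z))%C.
Proof.
  intros Hz.
  assert (H1 := one_minus_neq_0 z Hz). assert (H2 := one_plus_neq_0 z Hz).
  assert (H3 := one_minus_sqr_neq_0 z Hz).
  apply cderiv_eq with (/ ((1 + z) / (1 - z)) *
     (((0 + 1) * (1 - z) - (1 + z) * (0 - 1)) / ((1 - z) * (1 - z))))%C.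
  - apply (cderiv_comp (fun w => w) Clog); [apply ccont_id|now apply zderiv_Clog, cayley_Re_pos|].
    apply (cderiv_div (fun w => w) (fun z => 1 + z)%C (fun z => 1 - z)%C); auto using ccont_id.
    + apply cderiv_plus; [apply cderiv_const|apply cderiv_iota].
    + apply cderiv_minus; [apply cderiv_const|apply cderiv_iota].
  - replace (1 - z * z)%C with ((1 - z) * (1 + z))%C by ring. field. auto.
Qed.

(** The derivative of the sector function: a single formula covers the
    logarithmic case [al] = 0, where the exponential factor is 1. *)
Definition sector_derivative (al : R) (z : C) : C := (Cexp (al * log_cayley z) / (1 - z * z))%C.

Lemma zderiv_sector al z : in_disk z -> zderiv (sector al) z (sector_derivative al z).
Proof.
  intros Hz; assert (HL := zderiv_log_cayley z Hz).
  assert (H3 := one_minus_sqr_neq_0 z Hz).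
  unfold sector; destruct (Req_dec_T al 0) as [->|n].
  - apply cderiv_eq with (RtoC (/ 2) * (2 / (1 - z * z)))%C; [now apply cderiv_scal|].
    unfold sector_derivative; replace (0 * log_cayley z)%C with (RtoC 0) by ring.
    rewrite Cexp_0, RtoC_inv by lra; field; auto.
  - assert (n' : RtoC al <> RtoC 0) by (intros E; now apply RtoC_inj in E).
    apply cderiv_eq with (RtoC (/ (2 * al)) * (Cexp (al * log_cayley z) * (al * (2 / (1 - z * z))) - 0))%C.
    + apply cderiv_scal, cderiv_minus; [|apply cderiv_const].
      apply (cderiv_comp (fun w => w) Cexp (fun z => al * log_cayley z)%C);
        [apply ccont_id|apply zderiv_Cexp|now apply cderiv_scal].
    + unfold sector_derivative; rewrite RtoC_inv, RtoC_mult by lra; field; auto.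
Qed.

Lemma zderiv_sector_derivative al z : in_disk z ->
  zderiv (sector_derivative al) z (2 * (al + z) / (1 - z * z) * sector_derivative al z)%C.
Proof.
  intros Hz; assert (HL := zderiv_log_cayley z Hz).
  assert (H3 := one_minus_sqr_neq_0 z Hz).
  apply cderiv_eq with
    ((Cexp (al * log_cayley z) * (al * (2 / (1 - z * z))) * (1 - z * z)
      - Cexp (al * log_cayley z) * (0 - (1 * z + z * 1))) / ((1 - z * z) * (1 - z * z)))%C.
  - apply (cderiv_div (fun w => w) (fun z => Cexp (al * log_cayley z)) (fun z => 1 - z * z)%C);
      auto using ccont_id.
    + apply (cderiv_comp (fun w => w) Cexp (fun z => al * log_cayley z)%C);
        [apply ccont_id|apply zderiv_Cexp|now apply cderiv_scal].
    + apply cderiv_minus; [apply cderiv_const|].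
      apply (cderiv_mult (fun w => w) (fun w => w) (fun w => w));
        [apply ccont_id|apply cderiv_iota|apply cderiv_iota].
  - unfold sector_derivative; field; auto.
Qed.

Lemma sector_derivative_neq_0 al z : in_disk z -> sector_derivative al z <> RtoC 0.
Proof.
  intros Hz; unfold sector_derivative; apply Cmult_neq_0; [apply Cexp_neq_0|].
  assert (H3 := one_minus_sqr_neq_0 z Hz).
  intros E; assert (E2 : ((1 - z * z) * / (1 - z * z))%C = RtoC 0) by (rewrite E; ring).
  rewrite Cinv_r in E2 by auto. apply RtoC_inj in E2; lra.
Qed.

Lemma log_cayley_0 : log_cayley 0 = RtoC 0.
Proof.
  unfold log_cayley; replace ((1 + 0) / (1 - 0))%C with (RtoC 1).
  - unfold Clog; rewrite Carg_atan by (simpl; lra).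
    rewrite Cmod_1, ln_1; simpl; replace (0 / 1) with 0 by field; now rewrite atan_0.
  - field.
Qed.

Lemma sector_derivative_0 al : sector_derivative al 0 = RtoC 1.
Proof.
  unfold sector_derivative; rewrite log_cayley_0; replace (al * 0)%C with (RtoC 0) by ring.
  rewrite Cexp_0; replace (1 - 0 * 0)%C with (RtoC 1) by ring; field.
Qed.

Lemma sector_0 al : sector al 0 = RtoC 0.
Proof.
  assert (H := log_cayley_0); unfold log_cayley in H; unfold sector, Crpow; rewrite H.
  destruct (Req_dec_T al 0); [ring|].
  replace (al * 0)%C with (RtoC 0) by ring. rewrite Cexp_0; ring.
Qed.

(** * The quantity A_f and its consequences for convex functions *)

(** The value of A_f at [zeta] as a function of X = f''/f' there. *)
Definition A_value (zeta X : C) : C := (RtoC (/ 2 * (1 - Cmod zeta ^ 2)) * X - Cconj zeta)%C.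

(** The infimum is finite, since 0 is a lower bound, so that its conversion to a
    real number loses nothing. *)
Lemma lower_order_le f zeta : in_disk zeta -> lower_order f <= Cmod (A_op f zeta).
Proof.
  intros Hz; unfold lower_order.
  set (E := fun r : R => exists zeta : C, in_disk zeta /\ r = Cmod (A_op f zeta)).
  destruct (Glb_Rbar_correct E) as [H1 H2].
  assert (H3 := H1 (Cmod (A_op f zeta)) (ex_intro _ zeta (conj Hz eq_refl))).
  assert (H4 : Rbar_le 0 (Glb_Rbar E)).
  { apply H2; intros r [w [_ ->]]; simpl; apply Cmod_ge_0. }
  destruct (Glb_Rbar E); simpl in *; auto; try tauto.
Qed.

Lemma le_lower_order f m :
  (forall zeta, in_disk zeta -> m <= Cmod (A_op f zeta)) -> m <= lower_order f.
Proof.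
  intros H; unfold lower_order.
  set (E := fun r : R => exists zeta : C, in_disk zeta /\ r = Cmod (A_op f zeta)).
  destruct (Glb_Rbar_correct E) as [H1 H2].
  assert (H3 := H1 (Cmod (A_op f 0)) (ex_intro _ (RtoC 0) (conj in_disk_0 eq_refl))).
  assert (H4 : Rbar_le m (Glb_Rbar E)).
  { apply H2; intros r [w [Hw ->]]; simpl; auto. }
  destruct (Glb_Rbar E); simpl in *; auto; try tauto.
Qed.

Lemma zderiv_C_derive g z d : zderiv g z d -> C_derive g z = d.
Proof. intros H; now apply is_C_derive_unique, zderiv_is_derive. Qed.

Lemma A_op_eq (f f1 f2 : C -> C) :
  (forall z, in_disk z -> zderiv f z (f1 z) /\ zderiv f1 z (f2 z)) ->
  forall zeta, in_disk zeta -> A_op f zeta = A_value zeta (f2 zeta / f1 zeta)%C.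
Proof.
  intros H zeta Hz; unfold A_op, A_value.
  rewrite (zderiv_C_derive f zeta (f1 zeta)) by now apply H.
  rewrite (zderiv_C_derive (C_derive f) zeta (f2 zeta)); auto.
  apply cderiv_ext_loc with (2 := proj2 (H zeta Hz)).
  apply filter_imp with (2 := locally_in_disk zeta Hz); intros w Hw.
  symmetry; now apply zderiv_C_derive, H.
Qed.

Lemma Series_zero (u : nat -> R) : (forall n, u n = 0) -> Series u = 0.
Proof.
  intros H; rewrite (Series_ext u (fun n => 0 * u n)).
  - rewrite Series_scal_l; ring.
  - intros n; rewrite H; ring.
Qed.

Lemma power_sum_0 b : disk_summable b -> power_sum b 0 = b 0%nat.
Proof.
  intros Hb; destruct (ex_csum_power_sum b 0 Hb in_disk_0) as [E1 E2].
  unfold power_sum, csum.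
  rewrite (Series_incr_1 _ E1), (Series_incr_1 _ E2).
  rewrite !Series_zero.
  - destruct (b 0%nat) as [x y]; unfold Re, Im; simpl; f_equal; ring.
  - intros n; replace (b (S n) * 0 ^ S n)%C with (RtoC 0) by (simpl; ring); auto.
  - intros n; replace (b (S n) * 0 ^ S n)%C with (RtoC 0) by (simpl; ring); auto.
Qed.

Lemma expansion_derivatives (f : C -> C) (a : nat -> C) :
  normalized_expansion f a ->
  f 0 = RtoC 0 /\
  exists f1 f2 f3 : C -> C,
    (forall z, in_disk z ->
       zderiv f z (f1 z) /\ zderiv f1 z (f2 z) /\ zderiv f2 z (f3 z) /\ ccont f3 z) /\
    f1 0 = RtoC 1 /\ f2 0 = (2 * a 2%nat)%C.
Proof.
  intros Ha; assert (S0 := expansion_disk_summable f a Ha).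
  destruct Ha as [A0 [A1 A]].
  assert (S1 := disk_summable_pderive _ S0).
  assert (S2 := disk_summable_pderive _ S1).
  assert (S3 := disk_summable_pderive _ S2).
  assert (Ef : forall z, in_disk z -> power_sum a z = f z).
  { intros z Hz; now apply is_pseries_components, A. }
  split.
  { rewrite <- Ef by apply in_disk_0; now rewrite power_sum_0. }
  exists (power_sum (pderive a)), (power_sum (pderive (pderive a))), (power_sum (pderive (pderive (pderive a)))).
  split; [|split].
  - intros z Hz; repeat split; try now apply zderiv_power_sum.
    + apply cderiv_ext_loc with (2 := zderiv_power_sum a z S0 Hz).
      apply filter_imp with (2 := locally_in_disk z Hz); auto.
    + apply cderiv_ccont with (2 := zderiv_power_sum _ z S3 Hz), ccont_id.
  - rewrite power_sum_0 by auto; unfold pderive; rewrite A1; simpl; ring.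
  - rewrite power_sum_0 by auto; unfold pderive; simpl INR; rewrite RtoC_plus; ring.
Qed.

Definition moebius (c z : C) : C := ((z + c) / (1 + Cconj c * z))%C.

Lemma moebius_den_neq_0 c z : in_disk c -> in_disk z -> (1 + Cconj c * z)%C <> RtoC 0.
Proof.
  unfold in_disk; intros Hc Hz; apply one_plus_neq_0; unfold in_disk.
  rewrite Cmod_mult, Cmod_conj.
  generalize (Cmod_ge_0 c), (Cmod_ge_0 z); nra.
Qed.

Lemma Cmod_div_lt (p q : C) : q <> RtoC 0 -> Cmod p ^ 2 < Cmod q ^ 2 -> Cmod (p / q) < 1.
Proof.
  intros Hq H; rewrite Cmod_div by auto.
  apply Cmod_gt_0 in Hq; apply Rlt_div_l; auto; rewrite Rmult_1_l.
  generalize (Cmod_ge_0 p); nra.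
Qed.

Lemma Cmod_div_le (p q : C) : q <> RtoC 0 -> Cmod p ^ 2 <= Cmod q ^ 2 -> Cmod (p / q) <= 1.
Proof.
  intros Hq H; rewrite Cmod_div by auto.
  apply Cmod_gt_0 in Hq; apply Rle_div_l; auto; rewrite Rmult_1_l.
  generalize (Cmod_ge_0 p); nra.
Qed.

Lemma moebius_identity (c z : C) :
  Cmod (1 + Cconj c * z) ^ 2 - Cmod (z + c) ^ 2 = (1 - Cmod c ^ 2) * (1 - Cmod z ^ 2).
Proof. rewrite !Cmod2_alt; unfold Re, Im; simpl; ring. Qed.

Lemma moebius_in_disk c z : in_disk c -> in_disk z -> in_disk (moebius c z).
Proof.
  intros Hc Hz; apply Cmod_div_lt; [now apply moebius_den_neq_0|].
  assert (H := moebius_identity c z); unfold in_disk in *.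
  assert (0 < (1 - Cmod c ^ 2) * (1 - Cmod z ^ 2)); [|lra].
  apply Rmult_lt_0_compat; generalize (Cmod_ge_0 c), (Cmod_ge_0 z); nra.
Qed.

Lemma moebius_inv c z : in_disk c -> in_disk z -> moebius c (moebius (- c) z) = z.
Proof.
  intros Hc Hz.
  assert (H1 := moebius_den_neq_0 (- c) z (in_disk_opp c Hc) Hz).
  assert (H2 := moebius_den_neq_0 c _ Hc (moebius_in_disk _ _ (in_disk_opp c Hc) Hz)).
  rewrite Copp_conj in H1.
  unfold moebius in *; rewrite Copp_conj in *.
  assert (H3 : (1 - Cconj c * c)%C <> RtoC 0).
  { apply one_minus_neq_0; unfold in_disk in *; rewrite Cmod_mult, Cmod_conj.
    generalize (Cmod_ge_0 c); nra. }
  field; split; auto.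
  intros E; apply H3. rewrite <- E. ring.
Qed.

(** Precomposition with the disk automorphism taking 0 to [zeta] preserves
    injectivity and the image; the second coefficient of the composite is
    A_f(zeta) up to the factor given by its first coefficient. *)
Lemma convex_A_value_le_1 (f f1 f2 : C -> C) (zeta : C) :
  (forall z, in_disk z -> zderiv f z (f1 z) /\ zderiv f1 z (f2 z)) ->
  (forall z, in_disk z -> f1 z <> RtoC 0) ->
  injective_on_disk f -> convex_set (image_of_disk f) -> in_disk zeta ->
  Cmod (A_value zeta (f2 zeta / f1 zeta)) <= 1.
Proof.
  intros HD HN Hi Hconv Hz.
  set (den := fun z => (1 + Cconj zeta * z)%C).
  assert (Hden : forall z, in_disk z -> den z <> RtoC 0).
  { intros; now apply moebius_den_neq_0. }
  assert (HT := fun z => moebius_in_disk zeta z Hz).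
  set (k := (1 - Cconj zeta * zeta)%C).
  set (T1 := fun z => (k / (den z * den z))%C).
  set (T2 := fun z => (- (2) * Cconj zeta * k / (den z * den z * den z))%C).
  assert (Dden : forall z, zderiv den z (Cconj zeta)).
  { intros z; apply cderiv_eq with (0 + Cconj zeta * 1)%C; [|ring].
    apply cderiv_plus; [apply cderiv_const|apply cderiv_scal, cderiv_iota]. }
  assert (DT : forall z, in_disk z -> zderiv (moebius zeta) z (T1 z)).
  { intros z Hz'; assert (N := Hden z Hz').
    apply cderiv_eq with (((1 + 0) * den z - (z + zeta) * Cconj zeta) / (den z * den z))%C.
    - apply (cderiv_div (fun w => w) (fun z => z + zeta)%C den); auto using ccont_id.
      apply cderiv_plus; [apply cderiv_iota|apply cderiv_const].
    - unfold T1; f_equal; unfold den, k; ring. }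
  assert (DT1 : forall z, in_disk z -> zderiv T1 z (T2 z)).
  { intros z Hz'; assert (N := Hden z Hz').
    apply cderiv_eq with ((0 * (den z * den z) - k * (Cconj zeta * den z + den z * Cconj zeta))
       / (den z * den z * (den z * den z)))%C.
    - apply (cderiv_div (fun w => w) (fun _ => k) (fun z => den z * den z)%C);
        [apply ccont_id|now apply Cmult_neq_0|apply cderiv_const|].
      apply (cderiv_mult (fun w => w) den den); auto using ccont_id.
    - unfold T2; field; auto. }
  assert (Hk : k <> RtoC 0).
  { apply one_minus_neq_0; unfold in_disk in *; rewrite Cmod_mult, Cmod_conj.
    generalize (Cmod_ge_0 zeta); nra. }
  assert (Ek : k = RtoC (1 - Cmod zeta ^ 2)).
  { unfold k; rewrite RtoC_minus, Cmod2_conj; ring. }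
  assert (B := convex_second_coefficient (fun z => f (moebius zeta z))
    (fun z => f1 (moebius zeta z) * T1 z)%C
    (fun z => f2 (moebius zeta z) * T1 z * T1 z + f1 (moebius zeta z) * T2 z)%C).
  assert (den0 : den 0 = RtoC 1) by (unfold den; ring).
  assert (M0 : moebius zeta 0 = zeta).
  { unfold moebius; fold (den 0); rewrite den0; field. }
  assert (T10 : T1 0 = k) by (unfold T1; rewrite den0; field).
  assert (T20 : T2 0 = (- (2) * Cconj zeta * k)%C) by (unfold T2; rewrite den0; field).
  cbv beta in B; rewrite M0, T10, T20 in B.
  assert (N1 := HN zeta Hz).
  assert (B' : Cmod (f2 zeta * k * k + f1 zeta * (- (2) * Cconj zeta * k)) <= 2 * Cmod (f1 zeta * k)).
  { apply B.
    - intros z Hz'; split.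
      + apply (cderiv_comp (fun w => w) f (moebius zeta)); [apply ccont_id|apply HD; auto|auto].
      + apply (cderiv_mult (fun w => w) (fun z => f1 (moebius zeta z)) T1); auto using ccont_id.
        apply (cderiv_comp (fun w => w) f1 (moebius zeta)); [apply ccont_id|apply HD; auto|auto].
    - intros z Hz'; apply Cmult_neq_0; auto.
      unfold T1; intros E; apply Hk.
      replace k with (k / (den z * den z) * (den z * den z))%C by (field; auto).
      rewrite E; ring.
    - intros z w Hz1 Hw1 E; apply Hi in E; auto.
      rewrite <- (moebius_inv (- zeta)%C z), <- (moebius_inv (- zeta)%C w);
        auto using in_disk_opp.
      replace (- - zeta)%C with zeta by ring. now rewrite E.
    - intros u v t [z1 [Z1 E1]] [z2 [Z2 E2]] Ht.
      destruct (Hconv u v t) as [w [W1 W2]]; auto.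
      + exists (moebius zeta z1); auto.
      + exists (moebius zeta z2); auto.
      + exists (moebius (- zeta) w); split.
        * apply moebius_in_disk; auto using in_disk_opp.
        * rewrite moebius_inv; auto. }
  replace (f2 zeta * k * k + f1 zeta * (- (2) * Cconj zeta * k))%C
    with (2 * (f1 zeta * k) * A_value zeta (f2 zeta / f1 zeta))%C in B'.
  - rewrite !Cmod_mult, Cmod_R, Rabs_pos_eq in B' by lra.
    apply Cmod_gt_0 in N1. apply Cmod_gt_0 in Hk.
    assert (P : 0 < 2 * (Cmod (f1 zeta) * Cmod k)).
    { apply Rmult_lt_0_compat; [lra|now apply Rmult_lt_0_compat]. }
    apply Rmult_le_reg_l with (1 := P); lra.
  - unfold A_value; rewrite RtoC_mult, <- Ek, RtoC_inv by lra. field; auto.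
Qed.

(** The two bounds are equivalent, by the identity
    (1 - |z|^2) (|2 + z X|^2 - |X|^2) = 4 (1 - |A|^2). Vanishing of [2 + z X]
    would force X = 0, which is absurd. *)
Lemma A_value_le_1_bound (z X : C) :
  in_disk z -> Cmod (A_value z X) <= 1 ->
  (2 + z * X)%C <> RtoC 0 /\ Cmod (X / (2 + z * X)) <= 1.
Proof.
  unfold in_disk; intros Hz HA.
  assert (Hz0 := Cmod_ge_0 z). assert (HA0 := Cmod_ge_0 (A_value z X)).
  assert (I : (1 - Cmod z ^ 2) * (Cmod (2 + z * X) ^ 2 - Cmod X ^ 2) = 4 * (1 - Cmod (A_value z X) ^ 2)).
  { unfold A_value; rewrite !Cmod2_alt; unfold Re, Im; simpl; field. }
  assert (H : Cmod X ^ 2 <= Cmod (2 + z * X) ^ 2).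
  { assert (0 < 1 - Cmod z ^ 2) by nra.
    assert (0 <= 1 - Cmod (A_value z X) ^ 2) by nra. nra. }
  assert (N : (2 + z * X)%C <> RtoC 0).
  { intros E; rewrite E, Cmod_0 in H.
    assert (X0 : X = RtoC 0) by (apply Cmod_eq_0; nra).
    rewrite X0 in E; replace (2 + z * 0)%C with (RtoC 2) in E by ring.
    apply RtoC_inj in E; lra. }
  split; auto; now apply Cmod_div_le.
Qed.

Lemma critical_path (p : R -> C) (d : C) :
  rderiv p 0 d -> (forall t, -1 < t < 1 -> Cmod (p 0) <= Cmod (p t)) ->
  Re (Cconj (p 0) * d)%C = 0.
Proof.
  intros Hd Hmin.
  set (N := fun t => Re (p t) * Re (p t) + Im (p t) * Im (p t)).
  assert (DN : is_derive N 0 ((Re d * Re (p 0) + Re (p 0) * Re d) + (Im d * Im (p 0) + Im (p 0) * Im d))).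
  { assert (D1 := rderiv_Re _ _ _ Hd). assert (D2 := rderiv_Im _ _ _ Hd).
    apply (is_derive_plus (V := R_NormedModule) (fun t => Re (p t) * Re (p t)) (fun t => Im (p t) * Im (p t))).
    - apply (is_derive_mult (K := R_AbsRing) (fun t => Re (p t)) (fun t => Re (p t))); auto.
      intros; apply Rmult_comm.
    - apply (is_derive_mult (K := R_AbsRing) (fun t => Im (p t)) (fun t => Im (p t))); auto.
      intros; apply Rmult_comm. }
  apply is_derive_Reals in DN.
  assert (H := deriv_minimum N (-1) 1 0 (exist _ _ DN) ltac:(lra) ltac:(lra)).
  assert (H' : Re d * Re (p 0) + Re (p 0) * Re d + (Im d * Im (p 0) + Im (p 0) * Im d) = 0).
  { apply H; intros t H1 H2; unfold N.
    assert (H3 := Hmin t (conj H1 H2)).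
    assert (E0 := Cmod2_alt (p 0)). assert (E1 := Cmod2_alt (p t)).
    generalize (Cmod_ge_0 (p 0)); nra. }
  unfold Re, Im in *; simpl; lra.
Qed.

(** Along the ray t e the derivative of A_f at t = 0 is [c e - conj e]; minimality
    of |A_f| makes it orthogonal to A_f(0) = [a]. The directions e = 1 and e = i
    give the real and the imaginary part of the conclusion. *)
Lemma critical_coefficient (X : C -> C) (a c : C) :
  X 0 = (2 * a)%C -> zderiv X (RtoC 0) (2 * c)%C ->
  (forall z, in_disk z -> Cmod a <= Cmod (A_value z (X z))) -> (Cconj a * c)%C = a.
Proof.
  intros X0 DX Hmin.
  assert (Key : forall e : C, Cmod e = 1 -> Re (Cconj a * (c * e - Cconj e))%C = 0).
  { intros e He.
    set (p := fun t : R => (/ 2 * (1 - t * t) * X (t * e)%C - t * Cconj e)%C).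
    assert (P0 : p 0 = a).
    { unfold p; replace (0 * e)%C with (RtoC 0) by ring; rewrite X0; field. }
    assert (Ep : forall t, p t = A_value (t * e)%C (X (t * e)%C)).
    { intros t; unfold p, A_value; rewrite Cmult_conj, Cmod_mult, He, Cmod_R.
      replace (Cconj (RtoC t)) with (RtoC t) by (unfold Cconj; simpl; unfold RtoC; f_equal; ring).
      f_equal. f_equal. rewrite Rmult_1_r, <- Rsqr_pow2, <- Rsqr_abs; unfold Rsqr.
      rewrite RtoC_mult, RtoC_inv, RtoC_minus, RtoC_mult by lra. ring. }
    rewrite <- P0; apply critical_path.
    - assert (Dt : rderiv (fun t => t * e)%C 0 e).
      { apply cderiv_ext with (fun t => e * RtoC t)%C; [intros; ring|].
        apply cderiv_eq with (e * 1)%C; [|ring]. apply cderiv_scal, cderiv_iota. }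
      assert (DXt : rderiv (fun t => X (t * e)%C) 0 (2 * c * e)%C).
      { apply (cderiv_comp RtoC X (fun t => t * e)%C); [apply ccont_of_R| |auto].
        now replace (0 * e)%C with (RtoC 0) by ring. }
      assert (Dq : rderiv (fun t => / 2 * (1 - t * t))%C 0 (/ 2 * (0 - (1 * 0 + 0 * 1)))%C).
      { apply cderiv_scal, cderiv_minus; [apply cderiv_const|].
        apply (cderiv_mult RtoC RtoC RtoC); [apply ccont_of_R|apply cderiv_iota|apply cderiv_iota]. }
      apply cderiv_eq with ((/ 2 * (0 - (1 * 0 + 0 * 1))) * X (0 * e)
         + (/ 2 * (1 - 0 * 0)) * (2 * c * e) - Cconj e * 1)%C.
      + apply cderiv_minus.
        * apply (cderiv_mult RtoC (fun t => / 2 * (1 - t * t))%C (fun t => X (t * e))%C);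
            auto using ccont_of_R.
        * apply cderiv_ext with (fun t => Cconj e * RtoC t)%C; [intros; ring|].
          apply cderiv_scal, cderiv_iota.
      + field.
    - intros t Ht; rewrite P0, Ep; apply Hmin.
      unfold in_disk; rewrite Cmod_mult, He, Cmod_R, Rmult_1_r.
      apply Rabs_lt_between; lra. }
  assert (K1 := Key 1 Cmod_1).
  assert (K2 := Key Ci Cmod_Ci).
  destruct a as [a1 a2], c as [c1 c2]; unfold Re in *; simpl in *.
  unfold Cmult, Cconj; simpl; f_equal; lra.
Qed.

(** * Rigidity and the sector functions *)

(** For |a| < 1, the composite of [phi] with the automorphism taking [a] to 0 has
    derivative [mu] of modulus 1 at 0, so it is the rotation by [mu]. For
    |a| = 1 that automorphism degenerates, but then [z phi z] attains equality
    in the Schwarz lemma and [phi] is the constant [a]. *)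
Lemma schwarz_pick_equality (phi : C -> C) (a mu : C) :
  C1hol in_disk phi -> (forall z, in_disk z -> Cmod (phi z) <= 1) ->
  phi 0 = a -> zderiv phi (RtoC 0) (mu - a * a)%C ->
  Cmod mu = 1 -> (mu * Cconj a)%C = a ->
  forall z, in_disk z -> (phi z * (1 + a * z))%C = (a + mu * z)%C.
Proof.
  intros Hphi Hle H0 Dphi Hmu Hmua z Hz.
  assert (D0 := in_disk_0).
  assert (Ha : Cmod a <= 1) by (rewrite <- H0; now apply Hle).
  destruct Ha as [Ha|Ha].
  - assert (Hden : forall z, in_disk z -> (1 - Cconj a * phi z)%C <> RtoC 0).
    { intros w Hw; apply one_minus_neq_0; unfold in_disk; rewrite Cmod_mult, Cmod_conj.
      assert (H := Hle w Hw). generalize (Cmod_ge_0 a), (Cmod_ge_0 (phi w)); nra. }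
    set (psi := fun z => ((phi z - a) / (1 - Cconj a * phi z))%C).
    assert (Naa : (1 - Cconj a * a)%C <> RtoC 0) by (rewrite <- H0 at 2; now apply Hden).
    assert (E : psi z = (mu * z)%C).
    { apply schwarz_equality; auto.
      - apply C1hol_div; auto.
        + apply C1hol_minus; [auto|apply C1hol_const].
        + apply C1hol_minus; [apply C1hol_const|].
          apply C1hol_mult; [apply C1hol_const|auto].
      - intros w Hw; apply Cmod_div_le; auto.
        assert (I : Cmod (1 - Cconj a * phi w) ^ 2 - Cmod (phi w - a) ^ 2
          = (1 - Cmod a ^ 2) * (1 - Cmod (phi w) ^ 2))
          by (rewrite !Cmod2_alt; unfold Re, Im; simpl; ring).
        assert (H := Hle w Hw).
        assert (0 <= (1 - Cmod a ^ 2) * (1 - Cmod (phi w) ^ 2)); [|lra].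
        apply Rmult_le_pos; generalize (Cmod_ge_0 a), (Cmod_ge_0 (phi w)); nra.
      - unfold psi; rewrite H0; field; auto.
      - apply cderiv_eq with
          (((mu - a * a - 0) * (1 - Cconj a * phi 0) - (phi 0 - a) * (0 - Cconj a * (mu - a * a)))
            / ((1 - Cconj a * phi 0) * (1 - Cconj a * phi 0)))%C.
        + apply (cderiv_div (fun w => w) (fun z => phi z - a)%C (fun z => 1 - Cconj a * phi z)%C);
            [apply ccont_id|now apply Hden| |].
          * apply cderiv_minus; [auto|apply cderiv_const].
          * apply cderiv_minus; [apply cderiv_const|now apply cderiv_scal].
        + rewrite H0. rewrite <- Hmua at 2. field; auto. }
    assert (N := Hden z Hz).
    assert (E2 : (phi z - a)%C = (mu * z * (1 - Cconj a * phi z))%C).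
    { rewrite <- E; unfold psi; field; auto. }
    replace (phi z * (1 + a * z))%C with (phi z - a + a + phi z * (a * z))%C by ring.
    rewrite E2.
    replace (phi z * (a * z))%C with (mu * Cconj a * z * phi z)%C by (rewrite Hmua; ring).
    ring.
  - assert (Haa : (Cconj a * a)%C = RtoC 1).
    { rewrite Cmult_comm, <- Cmod2_conj, Ha; f_equal; ring. }
    assert (Emu : mu = (a * a)%C).
    { replace mu with (mu * Cconj a * a)%C by (rewrite <- Cmult_assoc, Haa; ring).
      now rewrite Hmua. }
    assert (E : (z * phi z)%C = (a * z)%C).
    { apply (schwarz_equality (fun z => z * phi z)%C); auto.
      - apply C1hol_mult; [apply C1hol_id|auto].
      - intros w Hw; rewrite Cmod_mult; assert (H := Hle w Hw); unfold in_disk in Hw.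
        generalize (Cmod_ge_0 w), (Cmod_ge_0 (phi w)); nra.
      - ring.
      - apply cderiv_eq with (1 * phi 0 + 0 * (mu - a * a))%C; [|rewrite H0; ring].
        apply (cderiv_mult (fun w => w) (fun w => w) phi); auto using ccont_id.
        apply cderiv_iota. }
    assert (E' : phi z = a).
    { destruct (Ceq_dec z 0) as [->|n]; auto.
      replace (phi z) with (z * phi z / z)%C by (field; auto).
      rewrite E; field; auto. }
    rewrite E', Emu; ring.
Qed.

Lemma constant_of_zderiv_0 (g : C -> C) (z : C) :
  (forall w, in_disk w -> zderiv g w 0) -> in_disk z -> g z = g 0.
Proof.
  unfold in_disk; intros H Hz.
  assert (M : Cmod (g z - g 0) <= 0 * Cmod (z - 0)).
  { apply (mean_value_inequality g (fun _ => RtoC 0)); intros s Hs.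
    rewrite Cmod_0; split; [|lra]. apply H.
    replace (0 + s * (z - 0))%C with (s * z)%C by ring.
    rewrite Cmod_mult, Cmod_R, Rabs_pos_eq by lra.
    generalize (Cmod_ge_0 z); nra. }
  rewrite Rmult_0_l in M.
  assert (M2 := Cmod_eq_0 _ (Rle_antisym _ _ M (Cmod_ge_0 _))).
  replace (g z) with (g z - g 0 + g 0)%C by ring. rewrite M2; ring.
Qed.

Lemma in_disk_rot l z : Cmod l = 1 -> in_disk z -> in_disk (l * z).
Proof. unfold in_disk; intros Hl; now rewrite Cmod_mult, Hl, Rmult_1_l. Qed.

Lemma Cconj_mult_unit l : Cmod l = 1 -> (Cconj l * l)%C = RtoC 1.
Proof. intros H; rewrite Cmult_comm, <- Cmod2_conj, H; f_equal; ring. Qed.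

Lemma zderiv_rot (g : C -> C) (l z d : C) :
  zderiv g (l * z)%C d -> zderiv (fun z => g (l * z)%C) z (d * l)%C.
Proof.
  intros H; apply (cderiv_comp (fun w => w) g (fun z => l * z)%C); auto using ccont_id.
  apply cderiv_eq with (l * 1)%C; [|ring]. apply cderiv_scal, cderiv_iota.
Qed.

(** Two functions with the same logarithmic derivative and the same value at 0
    coincide; this identifies f' with the derivative of the rotated sector
    function, and then f with the rotated sector function. *)
Lemma rotation_of_log_derivative (f f1 f2 : C -> C) (al : R) (l : C) :
  (forall z, in_disk z -> zderiv f z (f1 z) /\ zderiv f1 z (f2 z)) ->
  f 0 = RtoC 0 -> f1 0 = RtoC 1 -> Cmod l = 1 ->
  (forall z, in_disk z ->
     (f2 z * (1 - (l * z) * (l * z)))%C = (2 * l * (al + l * z) * f1 z)%C) ->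
  is_rotation_of f (sector al).
Proof.
  intros HD F0 F1 Hl HX.
  assert (Ell := Cconj_mult_unit l Hl).
  assert (L0 : (l * 0)%C = RtoC 0) by ring.
  assert (E1 : forall z, in_disk z -> f1 z = sector_derivative al (l * z)).
  { intros z Hz; assert (Hlz := in_disk_rot l z Hl Hz).
    assert (S := constant_of_zderiv_0 (fun z => f1 z / sector_derivative al (l * z))%C z).
    cbv beta in S; rewrite L0, sector_derivative_0, F1 in S.
    assert (N := sector_derivative_neq_0 al _ Hlz).
    replace (f1 z) with (f1 z / sector_derivative al (l * z) * sector_derivative al (l * z))%C by (field; auto).
    rewrite S; auto; [field|].
    intros w Hw; assert (Hlw := in_disk_rot l w Hl Hw).
    assert (N' := sector_derivative_neq_0 al _ Hlw).
    assert (N2 := one_minus_sqr_neq_0 _ Hlw).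
    apply cderiv_eq with ((f2 w * sector_derivative al (l * w) - f1 w *
      (2 * (al + l * w) / (1 - l * w * (l * w)) * sector_derivative al (l * w) * l))
      / (sector_derivative al (l * w) * sector_derivative al (l * w)))%C.
    - apply (cderiv_div (fun w => w) f1 (fun z => sector_derivative al (l * z))); auto using ccont_id.
      + now apply HD.
      + now apply zderiv_rot, zderiv_sector_derivative.
    - replace (f2 w) with (f2 w * (1 - l * w * (l * w)) / (1 - l * w * (l * w)))%C
        by (field; auto).
      rewrite HX by auto. field; auto. }
  exists l; split; auto; intros z Hz.
  assert (S := constant_of_zderiv_0 (fun z => f z - Cconj l * sector al (l * z))%C z).
  cbv beta in S; rewrite L0, sector_0, F0 in S.
  replace (f z) with (f z - Cconj l * sector al (l * z) + Cconj l * sector al (l * z))%C by ring.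
  rewrite S; auto; [ring|].
  intros w Hw; assert (Hlw := in_disk_rot l w Hl Hw).
  apply cderiv_eq with (f1 w - Cconj l * (sector_derivative al (l * w) * l))%C.
  - apply cderiv_minus; [now apply HD|].
    now apply cderiv_scal, zderiv_rot, zderiv_sector.
  - rewrite E1 by auto.
    replace (Cconj l * (sector_derivative al (l * w) * l))%C with (Cconj l * l * sector_derivative al (l * w))%C by ring.
    rewrite Ell; ring.
Qed.

(** The minimality at 0 puts equality into the Schwarz-Pick inequality for
    [phi] = [X / (2 + z X)], as explained at the top; here [al] = |a|,
    [l] = [a / al], and the unimodular constant is c = l^2. *)
Lemma extremal_is_rotation (f f1 f2 f3 : C -> C) (a : C) :
  (forall z, in_disk z ->
     zderiv f z (f1 z) /\ zderiv f1 z (f2 z) /\ zderiv f2 z (f3 z) /\ ccont f3 z) ->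
  f 0 = RtoC 0 -> f1 0 = RtoC 1 -> f2 0 = (2 * a)%C -> a <> RtoC 0 ->
  injective_on_disk f -> convex_set (image_of_disk f) ->
  (forall z, in_disk z -> Cmod a <= Cmod (A_value z (f2 z / f1 z))) ->
  exists alpha : R, 0 <= alpha <= 1 /\ is_rotation_of f (sector alpha).
Proof.
  intros HD F0 F10 F20 Ha Hi Hconv Hmin.
  assert (HD' : forall z, in_disk z -> zderiv f z (f1 z) /\ zderiv f1 z (f2 z)).
  { intros z Hz; split; now apply HD. }
  assert (K1 : forall z, in_disk z -> ccont f1 z).
  { intros z Hz; apply cderiv_ccont with (2 := proj2 (HD' z Hz)), ccont_id. }
  assert (HN : forall z, in_disk z -> f1 z <> RtoC 0).
  { apply injective_derivative_neq_0 with f; auto. intros z Hz; split; auto; now apply HD. }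
  assert (Hf1 : C1hol in_disk f1).
  { exists f2; intros z Hz; destruct (HD z Hz) as [_ [D1 [D2 _]]]; split; auto.
    apply cderiv_ccont with (2 := D2), ccont_id. }
  assert (Hf2 : C1hol in_disk f2).
  { exists f3; intros z Hz; split; now apply HD. }
  set (X := fun z => (f2 z / f1 z)%C).
  assert (HX : C1hol in_disk X) by now apply C1hol_div.
  assert (HB : forall z, in_disk z ->
    (2 + z * X z)%C <> RtoC 0 /\ Cmod (X z / (2 + z * X z)) <= 1).
  { intros z Hz; apply A_value_le_1_bound; auto. now apply convex_A_value_le_1 with f. }
  assert (D0 := in_disk_0).
  assert (X0 : X 0 = (2 * a)%C) by (unfold X; rewrite F10, F20; field).
  assert (DX : exists c, zderiv X (RtoC 0) (2 * c)%C).
  { destruct HX as [X' HX']; exists (X' 0 / 2)%C.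
    apply cderiv_eq with (X' 0); [now apply HX'|field]. }
  destruct DX as [c DX].
  assert (Hc := critical_coefficient X a c X0 DX Hmin).
  assert (Ha' := proj1 (Cmod_gt_0 a) Ha).
  set (al := Cmod a) in *. set (l := (a / al)%C).
  assert (Nal : RtoC al <> RtoC 0) by (intros E; apply RtoC_inj in E; lra).
  assert (Hl : Cmod l = 1).
  { unfold l; rewrite Cmod_div, Cmod_R, Rabs_pos_eq by (auto; lra). fold al; field; lra. }
  assert (Ell := Cconj_mult_unit l Hl).
  assert (Ea : a = (al * l)%C) by (unfold l; field; auto).
  assert (Eca : Cconj a = (al * Cconj l)%C).
  { rewrite Ea at 1; rewrite Cmult_conj; f_equal.
    unfold Cconj, RtoC; simpl; f_equal; ring. }
  assert (Ec : c = (l * l)%C).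
  { replace c with (Cconj l * l * c)%C by (rewrite Ell; ring).
    replace (Cconj l * l * c)%C with (al * Cconj l * c / al * l)%C by (field; auto).
    rewrite <- Eca, Hc; unfold l; field; auto. }
  assert (Pick := schwarz_pick_equality (fun z => X z / (2 + z * X z))%C a (l * l)%C).
  assert (Pick' : forall z, in_disk z ->
    (X z / (2 + z * X z) * (1 + a * z))%C = (a + l * l * z)%C).
  { apply Pick.
    - apply C1hol_div; auto; [|intros; now apply HB].
      apply C1hol_plus; [apply C1hol_const|apply C1hol_mult; [apply C1hol_id|auto]].
    - intros z Hz; now apply HB.
    - rewrite X0; field.
    - rewrite <- Ec.
      apply cderiv_eq with
        ((2 * c * (2 + 0 * X 0) - X 0 * (0 + (1 * X 0 + 0 * (2 * c)))) / ((2 + 0 * X 0) * (2 + 0 * X 0)))%C.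
      + apply (cderiv_div (fun w => w) X (fun z => 2 + z * X z)%C);
          [apply ccont_id|now apply HB|auto|].
        apply cderiv_plus; [apply cderiv_const|].
        apply (cderiv_mult (fun w => w) (fun w => w) X); auto using ccont_id.
        apply cderiv_iota.
      + rewrite X0; field.
    - rewrite Cmod_mult, Hl; ring.
    - rewrite Eca. replace (l * l * (al * Cconj l))%C with (al * l * (Cconj l * l))%C by ring.
      rewrite Ell, Ea; ring. }
  exists al; split.
  - split; [lra|]. apply Rle_trans with (1 := Hmin 0 D0).
    now apply convex_A_value_le_1 with f.
  - apply rotation_of_log_derivative with f1 f2 l; auto.
    intros z Hz; assert (P := Pick' z Hz). destruct (HB z Hz) as [N1 _].
    assert (N2 := HN z Hz).
    assert (E1 : (X z * (1 + a * z))%C = ((a + l * l * z) * (2 + z * X z))%C).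
    { rewrite <- P; field; auto. }
    assert (E2 : (X z * (1 - l * z * (l * z)))%C = (2 * l * (al + l * z))%C).
    { replace (X z * (1 - l * z * (l * z)))%C
        with (X z * (1 + a * z) - X z * (a * z + l * l * z * z))%C by ring.
      rewrite E1. rewrite Ea; ring. }
    rewrite <- E2; unfold X; field; auto.
Qed.

Lemma rotation_A_value_ge (f f1 f2 : C -> C) (al : R) (l : C) :
  (forall z, in_disk z -> zderiv f z (f1 z) /\ zderiv f1 z (f2 z)) ->
  0 <= al <= 1 -> Cmod l = 1 ->
  (forall z, in_disk z -> f z = (Cconj l * sector al (l * z))%C) ->
  f2 0 = (2 * l * al * f1 0)%C /\
  forall z, in_disk z -> al <= Cmod (A_value z (f2 z / f1 z)).
Proof.
  intros HD Hal Hl Hf.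
  assert (Ell := Cconj_mult_unit l Hl).
  assert (E1 : forall z, in_disk z -> f1 z = sector_derivative al (l * z)).
  { intros z Hz; rewrite <- (zderiv_C_derive f z (f1 z)) by now apply HD.
    apply zderiv_C_derive.
    apply cderiv_ext_loc with (fun z => Cconj l * sector al (l * z))%C.
    - apply filter_imp with (2 := locally_in_disk z Hz); intros w Hw; symmetry; auto.
    - apply cderiv_eq with (Cconj l * (sector_derivative al (l * z) * l))%C.
      + apply cderiv_scal, zderiv_rot, zderiv_sector; now apply in_disk_rot.
      + replace (Cconj l * (sector_derivative al (l * z) * l))%C with (Cconj l * l * sector_derivative al (l * z))%C by ring.
        rewrite Ell; ring. }
  assert (E2 : forall z, in_disk z ->
    f2 z = (2 * (al + l * z) / (1 - l * z * (l * z)) * f1 z * l)%C).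
  { intros z Hz; rewrite <- (zderiv_C_derive f1 z (f2 z)) by now apply HD.
    rewrite E1 by auto. apply zderiv_C_derive.
    apply cderiv_ext_loc with (fun z => sector_derivative al (l * z))%C.
    - apply filter_imp with (2 := locally_in_disk z Hz); intros w Hw; symmetry; auto.
    - now apply zderiv_rot, zderiv_sector_derivative, in_disk_rot. }
  split.
  - rewrite (E2 0 in_disk_0). replace (1 - l * 0 * (l * 0))%C with (RtoC 1) by ring. field.
  - intros z Hz; assert (Hw := in_disk_rot l z Hl Hz); set (w := (l * z)%C) in *.
    assert (N1 : f1 z <> RtoC 0) by (rewrite E1 by auto; now apply sector_derivative_neq_0).
    assert (N2 := one_minus_sqr_neq_0 w Hw).
    assert (Ez : z = (Cconj l * w)%C).
    { unfold w; replace (Cconj l * (l * z))%C with (Cconj l * l * z)%C by ring.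
      rewrite Ell; ring. }
    assert (Ecz : Cconj z = (l * Cconj w)%C) by (rewrite Ez, Cmult_conj, Cconj_conj; auto).
    assert (Em : Cmod z = Cmod w) by (unfold w; rewrite Cmod_mult, Hl; ring).
    set (P := 1 - Cmod w ^ 2).
    assert (ES : A_value z (f2 z / f1 z) = (l * ((al * P + (w - Cconj w)) / (1 - w * w)))%C).
    { unfold A_value; rewrite E2, Ecz, Em by auto; fold w P.
      rewrite RtoC_mult, RtoC_inv by lra.
      assert (EP : RtoC P = (1 - w * Cconj w)%C) by (unfold P; now rewrite RtoC_minus, Cmod2_conj).
      rewrite EP; field; auto. }
    rewrite ES, Cmod_mult, Hl, Rmult_1_l, Cmod_div by auto.
    apply Cmod_gt_0 in N2; apply Rle_div_r; auto.
    assert (I1 : Cmod (al * P + (w - Cconj w)) ^ 2 = (al * P) ^ 2 + 4 * Im w ^ 2).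
    { rewrite Cmod2_alt; unfold Re, Im; simpl; ring. }
    assert (I2 : Cmod (1 - w * w) ^ 2 = P ^ 2 + 4 * Im w ^ 2).
    { unfold P; rewrite !Cmod2_alt; unfold Re, Im; simpl; ring. }
    apply Rsqr_incr_0_var; [|apply Cmod_ge_0]; rewrite !Rsqr_pow2.
    rewrite Rpow_mult_distr, I1, I2.
    assert (al ^ 2 <= 1) by nra. generalize (pow2_ge_0 (Im w)); nra.
Qed.

Theorem lemma2 (f : C -> C) (a : nat -> C)
    (hf : class_C f) (ha : normalized_expansion f a) :
  lower_order f = Cmod (a 2%nat) <->
  (a 2%nat = RtoC 0 \/
   exists alpha : R, 0 <= alpha <= 1 /\ is_rotation_of f (sector alpha)).
Proof.
  destruct hf as [[[_ Hi] _] Hconv].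
  destruct (expansion_derivatives f a ha) as [F0 [f1 [f2 [f3 [HD [F10 F20]]]]]].
  assert (HD' : forall z, in_disk z -> zderiv f z (f1 z) /\ zderiv f1 z (f2 z)).
  { intros z Hz; split; now apply HD. }
  assert (EA := A_op_eq f f1 f2 HD').
  assert (D0 := in_disk_0).
  assert (A0 : A_op f 0 = a 2%nat).
  { rewrite EA, F10, F20 by auto; unfold A_value; rewrite Cmod_0.
    replace (/ 2 * (1 - 0 ^ 2)) with (/ 2) by ring. rewrite RtoC_inv by lra.
    replace (Cconj 0) with (RtoC 0) by (unfold Cconj, RtoC; simpl; f_equal; ring).
    field. }
  assert (Hup := lower_order_le f 0 D0); rewrite A0 in Hup.
  split.
  - intros Hlow; destruct (Ceq_dec (a 2%nat) 0) as [|n]; auto; right.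
    apply extremal_is_rotation with f1 f2 f3 (a 2%nat); auto.
    intros z Hz; rewrite <- EA, <- Hlow by auto. now apply lower_order_le.
  - intros H; apply Rle_antisym; auto; apply le_lower_order; intros z Hz.
    destruct H as [Z|[al [Hal [l [Hl Hf]]]]].
    + rewrite Z, Cmod_0; apply Cmod_ge_0.
    + destruct (rotation_A_value_ge f f1 f2 al l HD' Hal Hl Hf) as [G2 G1].
      rewrite EA by auto.
      replace (a 2%nat) with (l * al)%C.
      * rewrite Cmod_mult, Hl, Cmod_R, Rabs_pos_eq, Rmult_1_l by lra; auto.
      * rewrite F10, F20 in G2.
        replace (l * al)%C with (2 * l * al * 1 / 2)%C by field.
        rewrite <- G2; field.
Qed.
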